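(* Let $G$ be a finitely generated nilpotent group with a fixed finite generating set $X$. There is an algorithm which, given a finite subset $A = \{a_1,\ldots,a_n\} \subset G$ (each $a_i$ given as a word in $X \cup X^{-1}$), terminates and returns the set $$A_{inv} = \{g \in A \mid g^{-1} \in A^*\}.$$ In particular, since $e_G \in A^+$ if and only if $A_{inv} \neq \varnothing$, the Identity Problem for $G$ is decidable.
   Context: For a subset $A$ of a group $G$ with identity $e_G$, $A^+$ denotes the subsemigroup of $G$ generated by $A$ (all products of one or more elements of $A$, repetitions allowed), and $A^*$ denotes the submonoid generated by $A$ (so $A^* = A^+ \cup \{e_G\}$). The Identity Problem for a finitely generated group $G$ is the decision problem: given a finite subset $A \subset G$, whose elements are given as words in a fixed finite generating set $X$ of $G$ and inverses, decide whether $e_G \in A^+$. The group $G$ (via a finite presentation on $X$) is fixed and is not part of the input. *)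

(* Defs.v *)
From HB Require Import structures.
From mathcomp Require Import all_boot.
From mathcomp Require Import boolp classical_sets.

Set Implicit Arguments.
Unset Strict Implicit.
Unset Printing Implicit Defensive.

Local Open Scope classical_set_scope.

(** * Partial recursive functions (Kleene)

    [recf n] is the type of codes of [n]-ary partial recursive functions and
    [recf_eval f v y] means that [f] is defined at [v], with value [y]. *)

Inductive recf : nat -> Type :=
| RZero n : recf n
| RSucc : recf 1
| RProj n (i : 'I_n) : recf n
| RComp m n (f : recf m) (g : 'I_m -> recf n) : recf n
| RRec n (f : recf n) (g : recf n.+2) : recf n.+1
| RMin n (f : recf n.+1) : recf n.

Fixpoint recf_eval n (f : recf n) : n.-tuple nat -> nat -> Prop :=
  match f in recf n return n.-tuple nat -> nat -> Prop with
  | RZero _ => fun _ y => y = 0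
  | RSucc => fun v y => y = (thead v).+1
  | RProj _ i => fun v y => y = tnth v i
  | RComp m _ f g => fun v y =>
      exists2 w : m.-tuple nat,
        forall i, recf_eval (g i) v (tnth w i) & recf_eval f w y
  (* The recursion argument comes first; [r] lists the successive values. *)
  | RRec _ f g => fun v y => exists r : nat -> nat,
      [/\ recf_eval f (behead_tuple v) (r 0),
          forall i, i < thead v ->
            recf_eval g (cons_tuple i (cons_tuple (r i) (behead_tuple v)))
              (r i.+1)
        & y = r (thead v)]
  (* The values below the least zero must all be defined (and nonzero). *)
  | RMin _ f => fun v y =>
      recf_eval f (cons_tuple y v) 0 /\
      forall i, i < y -> exists z, recf_eval f (cons_tuple i v) z.+1
  end.

Lemma recf_eval_functional n (f : recf n) v y z :
  recf_eval f v y -> recf_eval f v z -> y = z.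
Proof.
elim: f v y z => {n} /=.
- by move=> n v y z -> ->.
- by move=> v y z -> ->.
- by move=> n i v y z -> ->.
- move=> m n f IHf g IHg v y z [w gw fw] [w' gw' fw'].
  apply: (IHf w) => //; suff -> : w = w' by [].
  by apply: eq_from_tnth => i; apply: IHg (gw i) (gw' i).
- move=> n f IHf g IHg v y z [r [r0 rS ->]] [s [s0 sS ->]].
  have: thead v <= thead v by [].
  elim: {1 3 4}(thead v) => [_|i IHi lti]; first exact: IHf r0 s0.
  apply: IHg (rS _ lti) _; rewrite IHi ?(ltnW lti) //; exact: sS.
- move=> n f IHf v y z [fy ymin] [fz zmin].
  case: (ltngtP y z) => // [/zmin|/ymin] [t ft].
  + by have := IHf _ _ _ fy ft.
  + by have := IHf _ _ _ fz ft.
Qed.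

Definition computable X Y (encX : X -> nat) (encY : Y -> nat) (f : X -> Y) :=
  exists p : recf 1, forall x, recf_eval p [tuple encX x] (encY (f x)).

Definition decidable_problem X (encX : X -> nat) (P : X -> Prop) :=
  exists d : X -> bool, computable encX nat_of_bool d /\ forall x, d x <-> P x.

(** * Words over k letters and their inverses

    [(i, false)] is the [i]-th generator and [(i, true)] is its inverse. *)

Definition word k := seq ('I_k * bool).

Definition encode_letter k (l : 'I_k * bool) : nat := l.1.*2 + l.2.

Definition encode_word k (w : word k) : nat :=
  CodeSeq.code (map (@encode_letter k) w).

Definition encode_words k (A : seq (word k)) : nat :=
  CodeSeq.code (map (@encode_word k) A).

Lemma encode_words_inj k : injective (@encode_words k).
Proof.
apply: inj_comp (can_inj CodeSeq.codeK) (inj_map _).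
apply: inj_comp (can_inj CodeSeq.codeK) (inj_map _).
move=> [i b] [j c]; rewrite /encode_letter /= => e.
have ebc : b = c by move/(congr1 odd): e; rewrite !oddD !odd_double !oddb.
move: e; rewrite ebc => /addIn/double_inj e; congr (_, _); exact: val_inj.
Qed.

(** * Groups *)

Local Open Scope group_scope.

Section Groups.
Variable G : groupType.
Implicit Types A S : set G.

Definition mul_stable S := forall x y, S x -> S y -> S (x * y).
Definition submonoid S := S 1 /\ mul_stable S.
Definition subgroup S := submonoid S /\ forall x, S x -> S x^-1.

Definition semigroup_gen A : set G := smallest mul_stable A.
Definition monoid_gen A : set G := smallest submonoid A.
Definition subgroup_gen A : set G := smallest subgroup A.

Fixpoint lower_central n : set G :=
  if n is n'.+1 then
    subgroup_gen [set [~ x, y] | x in lower_central n' & y in [set: G]]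
  else [set: G].

Definition nilpotent_group := exists n, lower_central n = [set 1].

Definition invertible_part A : set G :=
  [set g | A g /\ monoid_gen A g^-1].

Variables (k : nat) (X : k.-tuple G).

Definition generating := subgroup_gen [set tnth X i | i in [set: 'I_k]] = [set: G].

Definition word_val (w : word k) : G :=
  \prod_(l <- w) (if l.2 then (tnth X l.1)^-1 else tnth X l.1).

Definition set_of_words (A : seq (word k)) : set G :=
  [set word_val w | w in [set` A]].

Definition identity_problem (A : seq (word k)) : Prop :=
  semigroup_gen (set_of_words A) 1.

End Groups.

(* Main.v *)
Require Import Defs.
From HB Require Import structures.
From mathcomp Require Import all_boot all_order all_algebra generic_quotient.
From mathcomp Require Import boolp classical_sets.
From mathcomp Require Import ring lra.

Set Implicit Arguments.
Unset Strict Implicit.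
Unset Printing Implicit Defensive.

(** Write [A_inv] for the invertible part of [A] and let [H] be the group
    generated by [A].

    Saturation: a submonoid [M] of a finitely generated nilpotent group [H] with
    [M [H, H] = H] is all of [H].  Modulo the next term of the lower central
    series, commutators are central and bilinear: for [m, p] in [M] with
    inverses [m', p'] up to central factors, [m'^n p'^n m^n p^n] equals
    [[m, p]^(n^2)] times an [n]-th power, so that the quadratic exponent absorbs
    every linear error and [M] becomes closed under inverses.

    Hence, by linear programming duality applied to the lattice of relations of
    [A] in the abelianization of [H], either all elements of [A] are invertible
    in the monoid generated by [A], or some homomorphism from [H] to the integers
    is nonnegative and not identically zero on [A].  In the second case [A_inv] is
    contained in the kernel, and [A] is replaced by a proper subset with the same
    invertible part.

    Both alternatives are recursively enumerable, so that a search decides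
    between them.  For the first one this follows from the word problem.
    For the second one, weights on [A] extend to a homomorphism exactly when the
    subgroup of [G * Z] generated by the weighted elements meets [Z] trivially;
    this is certified along a polycyclic sequence, by exhibiting at each step
    generators of the intersection with the next term. *)


(** * Recursive functions *)

(** The group is an abstract type, so all computation is on words, coded as sequences of natural
    numbers. Since the group is fixed, finite data about it (a polycyclic sequence, tables of
    conjugates, orders modulo a subgroup) are chosen classically and enter the algorithm as
    constants. It is then enough to enumerate: equality of words is confirmed by search and never
    has to be refuted. The obstacle is the second alternative. That a weight extends to a
    homomorphism means that no pair [(1, k)] with [k] nonzero is generated, a universal condition.
    Its existential form rests on two facts: subgroups of polycyclic groups are finitely generated,
    so that a finite certificate exists, and the factor [Z] is central and torsion-free, so that a
    power of an element may be tested in place of the element. The dichotomy makes the resulting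
    search relation total, so unbounded search is a recursive function; as each step shortens the
    list or leaves it unchanged, iterating it as often as the list is long gives the answer. *)

Definition total_rec n (F : n.-tuple nat -> nat) :=
  exists p : recf n, forall v, recf_eval p v (F v).

Lemma total_rec_ext n (F H : n.-tuple nat -> nat) :
  F =1 H -> total_rec F -> total_rec H.
Proof. by move=> e [p pP]; exists p => v; rewrite -e. Qed.

Lemma total_rec_var n (i : 'I_n) : total_rec (fun v => tnth v i).
Proof. by exists (RProj i). Qed.

Lemma total_rec_comp m n (F : m.-tuple nat -> nat) (H : 'I_m -> n.-tuple nat -> nat) :
  total_rec F -> (forall i, total_rec (H i)) ->
  total_rec (fun v => F [tuple H i v | i < m]).
Proof.
move=> [p pP] /choice[q qP]; exists (RComp p q) => v /=.
by exists [tuple H i v | i < m] => // i; rewrite tnth_mktuple.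
Qed.

Lemma total_rec_prim n (F : n.-tuple nat -> nat) (H : n.+2.-tuple nat -> nat) :
  total_rec F -> total_rec H ->
  total_rec (fun v : n.+1.-tuple nat =>
    nat_rect (fun=> nat) (F (behead_tuple v))
      (fun i r => H (cons_tuple i (cons_tuple r (behead_tuple v)))) (thead v)).
Proof.
move=> [p pP] [q qP]; exists (RRec p q) => v /=.
by exists (fun k => nat_rect (fun=> nat) (F (behead_tuple v))
      (fun i r => H (cons_tuple i (cons_tuple r (behead_tuple v)))) k); split.
Qed.

(** [F] is total, so the definedness that [RMin] demands below the zero is automatic. *)
Lemma total_rec_min n (F : n.+1.-tuple nat -> nat) (H : n.-tuple nat -> nat) :
  total_rec F -> (forall v, F (cons_tuple (H v) v) = 0) ->
  (forall v i, i < H v -> F (cons_tuple i v) <> 0) -> total_rec H.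
Proof.
move=> [p pP] H0 Hlt; exists (RMin p) => v /=; split; first by rewrite -(H0 v).
move=> i /Hlt; have := pP (cons_tuple i v).
by case: (F _) => // m pm _; exists m.
Qed.

Lemma total_rec_comp1 n (f : nat -> nat) (g : n.-tuple nat -> nat) :
  total_rec (fun v : 1.-tuple nat => f (tnth v ord0)) -> total_rec g ->
  total_rec (fun v => f (g v)).
Proof.
move=> Cf Cg; have := total_rec_comp Cf (fun _ : 'I_1 => Cg).
by apply: total_rec_ext => v; rewrite tnth_mktuple.
Qed.

Lemma total_rec_comp2 n (f : nat -> nat -> nat) (g h : n.-tuple nat -> nat) :
  total_rec (fun v : 2.-tuple nat => f (tnth v ord0) (tnth v ord_max)) ->
  total_rec g -> total_rec h -> total_rec (fun v => f (g v) (h v)).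
Proof.
move=> Cf Cg Ch.
have CH (i : 'I_2) : total_rec (if i == ord0 then g else h) by case: ifP.
have := total_rec_comp Cf CH.
by apply: total_rec_ext => v; rewrite !tnth_mktuple.
Qed.

Lemma total_rec_succ n (g : n.-tuple nat -> nat) :
  total_rec g -> total_rec (fun v => (g v).+1).
Proof. by apply: (total_rec_comp1 (f := succn)); exists RSucc. Qed.

Lemma total_rec_const n c : total_rec (fun _ : n.-tuple nat => c).
Proof.
by elim: c => [|c /total_rec_succ //]; exists (RZero n).
Qed.

Lemma total_rec_natrec n (k f : n.-tuple nat -> nat)
    (g : nat -> nat -> n.-tuple nat -> nat) :
  total_rec k -> total_rec f ->
  total_rec (fun w : n.+2.-tuple nat =>
    g (tnth w ord0) (tnth w (lift ord0 ord0)) (behead_tuple (behead_tuple w))) ->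
  total_rec (fun v => nat_rect (fun=> nat) (f v) (fun i r => g i r v) (k v)).
Proof.
move=> Ck Cf Cg; have := total_rec_prim Cf Cg; set F := (X in total_rec X) => CF.
(* The tuple with [k v] put in front of [v]: [unlift ord0] separates the new slot from the shifted
   ones. *)
have CH (i : 'I_n.+1) :
    total_rec (fun v => if unlift ord0 i is Some j then tnth v j else k v).
  by case: unliftP => [j|] _ //; apply: total_rec_var.
have := total_rec_comp CF CH.
apply: total_rec_ext => v; rewrite /F /=; set w := [tuple _ | i < _].
have -> : thead w = k v by rewrite /thead tnth_mktuple unlift_none.
have -> : behead_tuple w = v.
  apply: eq_from_tnth => i; rewrite tnth_behead tnth_mktuple.
  have -> : inord i.+1 = lift ord0 i by apply: val_inj; rewrite /= inordK // ltnS.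
  by rewrite liftK.
elim: (k v) => //= m ->; congr g; exact: val_inj.
Qed.

Lemma total_rec_iter n (k f : n.-tuple nat -> nat) (g : nat -> nat) :
  total_rec k -> total_rec f -> total_rec (fun v : 1.-tuple nat => g (tnth v ord0)) ->
  total_rec (fun v => iter (k v) g (f v)).
Proof.
move=> Ck Cf Cg.
have := total_rec_natrec (g := fun _ r _ => g r) Ck Cf.
move=> /(_ (total_rec_comp1 Cg (total_rec_var _))).
by apply: total_rec_ext => v; elim: (k v) => //= m ->.
Qed.

Lemma total_rec_add n (f g : n.-tuple nat -> nat) :
  total_rec f -> total_rec g -> total_rec (fun v => f v + g v).
Proof.
move=> Cf Cg; have := total_rec_iter Cf Cg (total_rec_succ (total_rec_var _)).
by apply: total_rec_ext => v; rewrite iter_succn addnC.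
Qed.

Lemma total_rec_pred n (f : n.-tuple nat -> nat) :
  total_rec f -> total_rec (fun v => (f v).-1).
Proof.
move=> Cf; have := total_rec_natrec (g := fun i _ _ => i) Cf (total_rec_const _ 0)
  (total_rec_var _).
by apply: total_rec_ext => v; case: (f v).
Qed.

Lemma total_rec_sub n (f g : n.-tuple nat -> nat) :
  total_rec f -> total_rec g -> total_rec (fun v => f v - g v).
Proof.
move=> Cf Cg; have := total_rec_iter Cg Cf (total_rec_pred (total_rec_var _)).
by apply: total_rec_ext => v; elim: (g v) => [|m /= ->]; rewrite ?subn0 ?subnS.
Qed.

Lemma total_rec_mul n (f g : n.-tuple nat -> nat) :
  total_rec f -> total_rec g -> total_rec (fun v => f v * g v).
Proof.
move=> Cf; apply: (total_rec_comp2 (f := muln)) Cf.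
have C := total_rec_natrec (g := fun _ r v => tnth v ord_max + r)
   (total_rec_var ord0) (total_rec_const 2 0).
have := C (total_rec_add _ (total_rec_var (lift ord0 ord0))).
have C4 : total_rec (fun v : 4.-tuple nat =>
    tnth (behead_tuple (behead_tuple v)) ord_max).
  have := total_rec_var (ord_max : 'I_4); apply: total_rec_ext => v.
  by rewrite !tnth_behead; congr tnth; apply: val_inj; rewrite /= !inordK.
move=> /(_ C4); apply: total_rec_ext => v.
by elim: (tnth v ord0) => //= m ->; rewrite mulSn.
Qed.

Lemma total_rec_pow2 n (f : n.-tuple nat -> nat) :
  total_rec f -> total_rec (fun v => 2 ^ f v).
Proof.
move=> Cf; have := total_rec_iter (g := double) Cf (total_rec_const _ 1).
have C2 : total_rec (fun v : 1.-tuple nat => (tnth v ord0).*2).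
  have := total_rec_add (total_rec_var (ord0 : 'I_1)) (total_rec_var ord0).
  by apply: total_rec_ext => v; rewrite addnn.
move=> /(_ C2); apply: total_rec_ext => v.
by elim: (f v) => //= m ->; rewrite expnS mul2n.
Qed.

Lemma total_rec_odd n (f : n.-tuple nat -> nat) :
  total_rec f -> total_rec (fun v => odd (f v)).
Proof.
move=> Cf; have := total_rec_iter (g := fun r => 1 - r) Cf (total_rec_const _ 0).
move=> /(_ (total_rec_sub (total_rec_const _ 1) (total_rec_var _))).
by apply: total_rec_ext => v; elim: (f v) => //= m ->; case: odd.
Qed.

(** Passing from [i] to [i.+1] increases the half exactly when [i] is odd. *)
Lemma total_rec_half n (f : n.-tuple nat -> nat) :
  total_rec f -> total_rec (fun v => (f v)./2).
Proof.
move=> Cf; have := total_rec_natrec (g := fun i r _ => odd i + r) Cf (total_rec_const _ 0).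
move=> /(_ (total_rec_add (total_rec_odd (total_rec_var _)) (total_rec_var _))).
by apply: total_rec_ext => v; elim: (f v) => //= m ->; rewrite uphalf_half.
Qed.

(** * Bijective codes *)

(* The pairing is the one underlying [CodeSeq.code], so that the code of
    [x :: s] is the successor of the code of the pair [(x, s)]. *)

Definition pair_code (p : nat * nat) := (2 ^ p.1 * (p.2).*2.+1).-1.
Definition fst_code n := logn 2 n.+1.
Definition snd_code n := (n.+1 %/ 2 ^ fst_code n)./2.

Lemma pair_codeS p : (pair_code p).+1 = 2 ^ p.1 * (p.2).*2.+1.
Proof. by rewrite prednK // muln_gt0 expn_gt0. Qed.

Lemma fst_codeK a b : fst_code (pair_code (a, b)) = a.
Proof.
rewrite /fst_code pair_codeS lognM ?expn_gt0 // pfactorK //= lognE /=.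
by rewrite dvdn2 /= odd_double addn0.
Qed.

Lemma snd_codeK a b : snd_code (pair_code (a, b)) = b.
Proof.
by rewrite /snd_code fst_codeK pair_codeS mulKn ?expn_gt0 //= uphalf_double.
Qed.

Lemma half_iterE m a : iter a half m = m %/ 2 ^ a.
Proof. by elim: a => [|a /= ->]; rewrite ?divn1 // expnSr divnMA divn2. Qed.

Lemma odd_div_logn2 m : 0 < m -> odd (m %/ 2 ^ logn 2 m).
Proof.
move=> m_gt0; have [m' co_m' {1}->] := pfactor_coprime (isT : prime 2) m_gt0.
by rewrite mulnK ?expn_gt0 // -coprime2n.
Qed.

Lemma odd_div_pow2_lt m a : a < logn 2 m -> ~~ odd (m %/ 2 ^ a).
Proof.
move=> lt_a; have [->|m_gt0] := posnP m; first by rewrite div0n.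
rewrite -dvdn2 -(dvdn_pmul2l (expn_gt0 2 a : 0 < 2 ^ a)) -expnSr.
by rewrite [_ * (_ %/ _)]mulnC divnK pfactor_dvdn // ltnW.
Qed.

Lemma codeK n : pair_code (fst_code n, snd_code n) = n.
Proof.
apply: succn_inj; rewrite pair_codeS /= /snd_code; have := odd_double_half.
move=> /(_ (n.+1 %/ 2 ^ fst_code n)); rewrite odd_div_logn2 // add1n => ->.
by rewrite mulnC divnK // pfactor_dvdnn.
Qed.

Lemma total_rec_pair n (f g : n.-tuple nat -> nat) :
  total_rec f -> total_rec g -> total_rec (fun v => pair_code (f v, g v)).
Proof.
move=> Cf Cg; apply/total_rec_pred/total_rec_mul; first exact: total_rec_pow2.
apply: (@total_rec_ext _ (fun v => (g v + g v).+1)) => [v|]; first by rewrite addnn.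
exact/total_rec_succ/total_rec_add.
Qed.

(** The 2-adic valuation of [n.+1] is the least number of halvings that makes it odd, which is found
    by minimization. *)
Lemma total_rec_fst n (f : n.-tuple nat -> nat) :
  total_rec f -> total_rec (fun v => fst_code (f v)).
Proof.
apply: total_rec_comp1.
have maxE i (v : 1.-tuple nat) : tnth (cons_tuple i v) ord_max = tnth v ord0.
  by rewrite (_ : ord_max = lift ord0 ord0) ?tnthS //; apply: val_inj.
apply: (@total_rec_min _
  (fun w => 1 - odd (iter (tnth w ord0) half (tnth w ord_max).+1))).
- apply/total_rec_sub/total_rec_odd/total_rec_iter; first exact: total_rec_const.
  + exact: total_rec_var.
  + exact/total_rec_succ/total_rec_var.
  + exact/total_rec_half/total_rec_var.
- move=> v; cbv beta; rewrite half_iterE tnth0.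
  by rewrite maxE odd_div_logn2.
- move=> v i; cbv beta; rewrite half_iterE tnth0.
  by rewrite maxE => /odd_div_pow2_lt; case: odd.
Qed.

Lemma total_rec_snd n (f : n.-tuple nat -> nat) :
  total_rec f -> total_rec (fun v => snd_code (f v)).
Proof.
move=> Cf; apply/total_rec_half.
have := total_rec_iter (total_rec_fst Cf) (total_rec_succ Cf)
  (total_rec_half (total_rec_var _)).
by apply: total_rec_ext => v; rewrite half_iterE.
Qed.

(** Codes are bijections with [nat]: every number decodes, so functions between such types are total
    functions of codes and no validity test is needed. *)
Structure codeType := CodeType {
  code_sort :> Type;
  enc : code_sort -> nat;
  dec : nat -> code_sort;
  encK : cancel enc dec;
  decK : cancel dec enc }.

Canonical nat_codeType :=
  @CodeType nat id id (fun _ => erefl) (fun _ => erefl).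

Section ProdCode.
Variables X Y : codeType.
Let enc_prod (p : X * Y) := pair_code (enc p.1, enc p.2).
Let dec_prod n := (dec X (fst_code n), dec Y (snd_code n)).

Fact enc_prodK : cancel enc_prod dec_prod.
Proof. by case=> x y; rewrite /dec_prod fst_codeK snd_codeK !encK. Qed.

Fact dec_prodK : cancel dec_prod enc_prod.
Proof. by move=> n; rewrite /enc_prod /= !decK codeK. Qed.

Canonical prod_codeType := CodeType enc_prodK dec_prodK.
End ProdCode.

Section SeqCode.
Variable X : codeType.
Let enc_seq (s : seq X) := CodeSeq.code (map (@enc X) s).
Let dec_seq n := map (dec X) (CodeSeq.decode n).

Fact enc_seqK : cancel enc_seq dec_seq.
Proof. by move=> s; rewrite /dec_seq CodeSeq.codeK (mapK (@encK X)). Qed.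

Fact dec_seqK : cancel dec_seq enc_seq.
Proof. by move=> n; rewrite /enc_seq (mapK (@decK X)) CodeSeq.decodeK. Qed.

Canonical seq_codeType := CodeType enc_seqK dec_seqK.
End SeqCode.

Arguments enc : simpl never.
Arguments dec : simpl never.

Lemma enc_cons (X : codeType) (x : X) s : enc (x :: s) = (pair_code (enc x, enc s)).+1.
Proof. by rewrite pair_codeS. Qed.

Lemma enc_pair (X Y : codeType) (x : X) (y : Y) : enc (x, y) = pair_code (enc x, enc y).
Proof. by []. Qed.

(** This bounds the length of a loop over [s] by a number available before [size] is known to be
    recursive. *)
Lemma size_le_enc (X : codeType) (s : seq X) : size s <= enc s.
Proof.
elim: s => // x s IHs; rewrite enc_cons pair_codeS /=.
apply: leq_ltn_trans IHs _; apply: (@leq_trans (enc s).*2.+1).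
  by rewrite ltnS -addnn leq_addr.
by rewrite leq_pmull // expn_gt0.
Qed.

Definition recursive (X Y : codeType) (f : X -> Y) :=
  total_rec (fun v : 1.-tuple nat => enc (f (dec X (tnth v ord0)))).

Lemma recursive_ext (X Y : codeType) (f g : X -> Y) : f =1 g -> recursive f -> recursive g.
Proof. by move=> e; apply: total_rec_ext => v; rewrite e. Qed.

Section RecursiveClosure.
Variables X Y Z : codeType.

Lemma recursive_comp (f : Y -> Z) (g : X -> Y) :
  recursive f -> recursive g -> recursive (fun x => f (g x)).
Proof.
move=> Cf Cg; have := total_rec_comp1 (f := fun n => enc (f (dec Y n))) Cf Cg.
by apply: total_rec_ext => v; rewrite encK.
Qed.

Lemma recursive_id : recursive (fun x : X => x).
Proof. by apply: total_rec_ext (total_rec_var _) => v; rewrite decK. Qed.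

Lemma recursive_const (c : Y) : recursive (fun _ : X => c).
Proof. exact: total_rec_const. Qed.

Lemma recursive_pair (f : X -> Y) (g : X -> Z) :
  recursive f -> recursive g -> recursive (fun x => (f x, g x)).
Proof. exact: total_rec_pair. Qed.

Lemma recursive_fst (f : X -> Y * Z) : recursive f -> recursive (fun x => (f x).1).
Proof.
move=> /total_rec_fst; apply: total_rec_ext => v.
by rewrite (surjective_pairing (f _)) enc_pair fst_codeK.
Qed.

Lemma recursive_snd (f : X -> Y * Z) : recursive f -> recursive (fun x => (f x).2).
Proof.
move=> /total_rec_snd; apply: total_rec_ext => v.
by rewrite (surjective_pairing (f _)) enc_pair snd_codeK.
Qed.

Lemma recursive_succ (f : X -> nat) : recursive f -> recursive (fun x => (f x).+1).
Proof. exact: total_rec_succ. Qed.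

Lemma recursive_add (f g : X -> nat) :
  recursive f -> recursive g -> recursive (fun x => f x + g x).
Proof. exact: total_rec_add. Qed.

Lemma recursive_sub (f g : X -> nat) :
  recursive f -> recursive g -> recursive (fun x => f x - g x).
Proof. exact: total_rec_sub. Qed.

Lemma recursive_mul (f g : X -> nat) :
  recursive f -> recursive g -> recursive (fun x => f x * g x).
Proof. exact: total_rec_mul. Qed.

Lemma recursive_enc (f : X -> Y) : recursive f -> recursive (fun x => enc (f x)).
Proof. by []. Qed.

Lemma recursive_natrec (k : X -> nat) (a : X -> Z) (g : X * (nat * Z) -> Z) :
  recursive k -> recursive a -> recursive g ->
  recursive (fun x => nat_rect (fun=> Z) (a x) (fun i z => g (x, (i, z))) (k x)).
Proof.
move=> Ck Ca Cg.
have Cg' : total_rec (fun w : 3.-tuple nat => enc (g (dec _ (pair_code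
    (tnth w ord_max, pair_code (tnth w ord0, tnth w (lift ord0 ord0))))))).
  apply: (total_rec_comp1 (f := fun n => enc (g (dec _ n))) Cg).
  by apply: total_rec_pair; [|apply: total_rec_pair]; apply: total_rec_var.
apply: (total_rec_ext _ (total_rec_natrec (g := fun i r v =>
    enc (g (dec X (tnth v ord0), (i, dec Z r)))) Ck Ca _)) => [v|].
  rewrite -[enc (k _)]/(k _); by elim: (k _) => //= m ->; rewrite encK.
apply: total_rec_ext Cg' => w.
rewrite -[in LHS](decK X (tnth w ord_max)) -[tnth w (lift _ _)](decK Z).
rewrite -(enc_pair (tnth w ord0 : nat) (dec Z _)) -enc_pair encK decK.
congr (enc (g (dec X _, _))).
by rewrite !tnth_behead; congr tnth; apply: val_inj; rewrite /= !inordK.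
Qed.

Lemma recursive_ifS (k : X -> nat) (a b : X -> Z) :
  recursive k -> recursive a -> recursive b ->
  recursive (fun x => if k x is _.+1 then b x else a x).
Proof.
move=> Ck Ca Cb.
apply: (recursive_ext _ (recursive_natrec Ck Ca (g := fun p => b p.1) _)).
  by move=> x; case: (k x).
apply: total_rec_ext (total_rec_comp1 (f := fun n => enc (b (dec X n))) Cb
  (total_rec_fst (total_rec_var _))) => v.
by [].
Qed.

End RecursiveClosure.

Lemma recursive_fst_fun (X Y : codeType) : @recursive (prod_codeType X Y) X fst.
Proof. exact/recursive_fst/recursive_id. Qed.

Lemma recursive_snd_fun (X Y : codeType) : @recursive (prod_codeType X Y) Y snd.
Proof. exact/recursive_snd/recursive_id. Qed.

Ltac recursive_step := match goal with
  | |- recursive (fun x => x) => exact: recursive_id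
  | |- recursive (fun x => ?c) => exact: recursive_const
  | |- recursive fst => exact: recursive_fst_fun
  | |- recursive snd => exact: recursive_snd_fun
  | |- recursive (fun x => (_, _)) => apply: recursive_pair
  | |- recursive (fun x => _.1) => apply: recursive_fst
  | |- recursive (fun x => _.2) => apply: recursive_snd
  | |- recursive _ => assumption
  end.
Ltac rec := repeat recursive_step.

Lemma recursive_cons (X Y : codeType) (f : X -> Y) (g : X -> seq Y) :
  recursive f -> recursive g -> recursive (fun x => f x :: g x).
Proof.
move=> Cf Cg; apply: total_rec_ext (total_rec_succ (total_rec_pair Cf Cg)) => v.
by rewrite enc_cons.
Qed.

Lemma recursive_behead (X Y : codeType) (f : X -> seq Y) :
  recursive f -> recursive (fun x => behead (f x)).
Proof.
move=> Cf; apply: total_rec_ext (total_rec_snd (total_rec_pred Cf)) => v.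
by case: (f _) => // y s; rewrite enc_cons snd_codeK.
Qed.

Lemma recursive_head (X Y : codeType) (d : Y) (f : X -> seq Y) :
  recursive f -> recursive (fun x => head d (f x)).
Proof.
move=> Cf; have Cp : recursive (fun x => fst_code (enc (f x)).-1).
  exact/total_rec_fst/total_rec_pred.
have Cd : recursive (fun _ : X => enc d) by rec.
apply: total_rec_ext (recursive_ifS (recursive_enc Cf) Cd Cp) => v.
by case: (f _) => // y s; rewrite enc_cons /= fst_codeK.
Qed.

(** The state of the recursion is the remaining sequence with the accumulator. It runs for
    [enc (s x)] steps, which is enough; surplus steps change nothing, because the empty sequence has
    code 0 and [G] then keeps the accumulator. *)
Lemma recursive_foldl (X Y Z : codeType) (a : X -> Z) (s : X -> seq Y) (g : X * (Z * Y) -> Z) :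
  recursive a -> recursive s -> recursive g ->
  recursive (fun x => foldl (fun z y => g (x, (z, y))) (a x) (s x)).
Proof.
move=> Ca Cs Cg; pose d := dec Y 0.
pose G (p : X * (nat * (seq Y * Z))) :=
  (behead p.2.2.1, if enc p.2.2.1 is _.+1
     then g (p.1, (p.2.2.2, head d p.2.2.1)) else p.2.2.2).
have CG : recursive G.
  apply: recursive_pair; first by apply: recursive_behead; rec.
  apply: (recursive_ifS (k := fun p => enc p.2.2.1) (a := fun p => p.2.2.2)
    (b := fun p => g (p.1, (p.2.2.2, head d p.2.2.1)))).
  - by apply: recursive_enc; rec.
  - by rec.
  by apply: recursive_comp Cg _; rec; apply: recursive_head; rec.
have := recursive_snd (recursive_natrec (recursive_enc Cs) (recursive_pair Cs Ca) CG).
apply: recursive_ext => x.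
have: size (s x) <= enc (s x) by apply: size_le_enc.
suff FE n : nat_rect (fun=> _) (s x, a x) (fun i z => G (x, (i, z))) n =
    (drop n (s x), foldl (fun z y => g (x, (z, y))) (a x) (take n (s x))).
  by move=> le_s; rewrite FE /= take_oversize.
elim: n => [|n IHn]; first by rewrite drop0 take0.
rewrite [LHS]/= {}IHn /G /= -drop1 drop_drop add1n; congr (_, _).
have [le_s|lt_s] := leqP (size (s x)) n.
  by rewrite drop_oversize // !take_oversize // leqW.
by rewrite (drop_nth d) // enc_cons (take_nth d) // foldl_rcons.
Qed.

Lemma recursive_rev (X Y : codeType) (s : X -> seq Y) : recursive s -> recursive (fun x => rev (s x)).
Proof.
move=> Cs; apply: (recursive_ext _ (recursive_foldl (Z := seq_codeType Y) (g := fun p => p.2.2 :: p.2.1)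
  (recursive_const _ [::]) Cs _)) => [x|]; last by apply: recursive_cons; rec.
by rewrite -[s x in LHS]revK foldl_rev; elim: (rev _) => //= y t ->.
Qed.

Lemma recursive_foldr (X Y Z : codeType) (a : X -> Z) (s : X -> seq Y) (g : X * (Y * Z) -> Z) :
  recursive a -> recursive s -> recursive g ->
  recursive (fun x => foldr (fun y z => g (x, (y, z))) (a x) (s x)).
Proof.
move=> Ca Cs Cg; apply: (recursive_ext _ (recursive_foldl
    (g := fun p => g (p.1, (p.2.2, p.2.1))) Ca (recursive_rev Cs) _)) => [x|].
  by rewrite foldl_rev.
by apply: recursive_comp Cg _; rec.
Qed.

Lemma recursive_size (X Y : codeType) (s : X -> seq Y) : recursive s -> recursive (fun x => size (s x)).
Proof.
move=> Cs; apply: (recursive_ext _ (recursive_foldr (g := fun p => p.2.2.+1)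
  (recursive_const _ 0) Cs _)) => [x|]; last by apply: recursive_succ; rec.
by elim: (s x) => //= y t ->.
Qed.

Lemma recursive_cat (X Y : codeType) (s t : X -> seq Y) :
  recursive s -> recursive t -> recursive (fun x => s x ++ t x).
Proof.
move=> Cs Ct; apply: (recursive_ext _ (recursive_foldr (g := fun p => p.2.1 :: p.2.2)
  Ct Cs _)) => [x|]; last by apply: recursive_cons; rec.
by elim: (s x) => //= y u ->.
Qed.

Lemma recursive_map (X Y Z : codeType) (f : X * Y -> Z) (s : X -> seq Y) :
  recursive f -> recursive s -> recursive (fun x => [seq f (x, y) | y <- s x]).
Proof.
move=> Cf Cs; apply: (recursive_ext _ (recursive_foldr
    (g := fun p => f (p.1, p.2.1) :: p.2.2) (recursive_const _ [::]) Cs _)) => [x|].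
  by elim: (s x) => //= y u ->.
by apply: recursive_cons; [apply: recursive_comp Cf _|]; rec.
Qed.

Lemma recursive_nth (X Y : codeType) (d : Y) (s : X -> seq Y) (k : X -> nat) :
  recursive s -> recursive k -> recursive (fun x => nth d (s x) (k x)).
Proof.
move=> Cs Ck; apply: (recursive_ext _ (recursive_head d (recursive_natrec
    (g := fun p => behead p.2.2) Ck Cs _))) => [x|].
  rewrite -[k x in RHS]addn0 -nth_drop nth0; congr head.
  by elim: (k x) => [|n /= ->]; rewrite ?drop0 // -drop1 drop_drop add1n.
by apply: recursive_behead; rec.
Qed.

Lemma recursive_if_eq (X Z : codeType) (f g : X -> nat) (a b : X -> Z) :
  recursive f -> recursive g -> recursive a -> recursive b ->
  recursive (fun x => if f x == g x then a x else b x).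
Proof.
move=> Cf Cg Ca Cb.
have Cd := recursive_add (recursive_sub Cf Cg) (recursive_sub Cg Cf).
apply: recursive_ext (recursive_ifS Cd Ca Cb) => x.
rewrite eqn_leq -!subn_eq0 -addn_eq0; by case: (_ + _).
Qed.

(** A finite table is a homomorphism of free monoids, sending letters beyond the table to the empty
    word. Conversely, as [w] varies, [subst T w] runs through all products of entries of [T], that
    is, through the submonoid that they generate. *)
Definition subst (T : seq (seq nat)) (w : seq nat) :=
  flatten [seq nth [::] T l | l <- w].

Lemma subst_cons T l w : subst T (l :: w) = nth [::] T l ++ subst T w.
Proof. by []. Qed.

Lemma subst_cat T u v : subst T (u ++ v) = subst T u ++ subst T v.
Proof. by rewrite /subst map_cat flatten_cat. Qed.

Lemma recursive_subst (X : codeType) (T : X -> seq (seq nat)) (w : X -> seq nat) :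
  recursive T -> recursive w -> recursive (fun x => subst (T x) (w x)).
Proof.
move=> CT Cw; apply: (recursive_ext _ (recursive_foldr
  (g := fun p => nth [::] (T p.1) p.2.1 ++ p.2.2) (recursive_const _ [::]) Cw _)) => [x|].
  by rewrite /subst; elim: (w x) => //= l u ->.
apply: recursive_cat; last by rec.
by apply: recursive_nth; [apply: recursive_comp CT _|]; rec.
Qed.

(** * Recursively enumerable predicates *)

Definition r_e (X : codeType) (P : X -> Prop) :=
  exists2 f : X * nat -> nat, recursive f & forall x, P x <-> exists n, f (x, n) = 0.

Lemma r_e_ext (X : codeType) (P Q : X -> Prop) : (forall x, P x <-> Q x) -> r_e P -> r_e Q.
Proof. by move=> e [f Cf fP]; exists f => // x; rewrite -e. Qed.

Lemma r_e_preimage (X Y : codeType) (P : Y -> Prop) (g : X -> Y) :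
  r_e P -> recursive g -> r_e (fun x => P (g x)).
Proof.
move=> [f Cf fP] Cg; exists (fun p => f (g p.1, p.2)) => [|x //].
by apply: recursive_comp Cf _; rec; apply: recursive_comp Cg _; rec.
Qed.

(** One of two constant functions works; choosing between them is a classical step. *)
Lemma r_e_const (X : codeType) (P : Prop) : r_e (fun _ : X => P).
Proof.
exists (fun _ => if pselect P then 0 else 1) => [|x]; first by rec.
by case: pselect => p; split=> //; [exists 0 | case].
Qed.

Lemma r_e_eq (X Y : codeType) (f g : X -> Y) : recursive f -> recursive g -> r_e (fun x => f x = g x).
Proof.
move=> Cf Cg.
exists (fun p => (enc (f p.1) - enc (g p.1)) + (enc (g p.1) - enc (f p.1))) => [|x /=].
  by apply: recursive_add; apply: recursive_sub; apply: recursive_enc;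
    (apply: recursive_comp Cf _ || apply: recursive_comp Cg _); rec.
split=> [->|[_ /eqP]]; first by exists 0; rewrite subnn.
rewrite addn_eq0 !subn_eq0 -eqn_leq => /eqP; exact: (can_inj (@encK Y)).
Qed.

Lemma r_e_lt (X : codeType) (f g : X -> nat) : recursive f -> recursive g -> r_e (fun x => f x < g x).
Proof.
move=> Cf Cg; exists (fun p => (f p.1).+1 - g p.1) => [|x /=].
  by apply: recursive_sub; [apply: recursive_succ|];
    (apply: recursive_comp Cf _ || apply: recursive_comp Cg _); rec.
by split=> [lt|[_ /eqP]]; [exists 0; apply/eqP|]; rewrite subn_eq0.
Qed.

Lemma r_e_and (X : codeType) (P Q : X -> Prop) : r_e P -> r_e Q -> r_e (fun x => P x /\ Q x).
Proof.
move=> [f Cf fP] [g Cg gQ].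
exists (fun p => f (p.1, fst_code p.2) + g (p.1, snd_code p.2)) => [|x].
  have CF : recursive fst_code by exact/total_rec_fst/total_rec_var.
  have CS : recursive snd_code by exact/total_rec_snd/total_rec_var.
  by apply: recursive_add; [apply: recursive_comp Cf _ | apply: recursive_comp Cg _];
    apply: recursive_pair; rec; [apply: recursive_comp CF _ | apply: recursive_comp CS _]; rec.
rewrite fP gQ; split=> [[[m fm] [n gn]]|[n /eqP]].
  by exists (pair_code (m, n)); rewrite /= fst_codeK snd_codeK fm gn.
by rewrite addn_eq0 => /andP[/eqP ? /eqP ?]; split; [exists (fst_code n) | exists (snd_code n)].
Qed.

Lemma r_e_or (X : codeType) (P Q : X -> Prop) : r_e P -> r_e Q -> r_e (fun x => P x \/ Q x).
Proof.
move=> [f Cf fP] [g Cg gQ]; exists (fun p => f p * g p) => [|x].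
  exact: recursive_mul.
rewrite fP gQ; split=> [[] [n e]|[n /eqP]]; first by exists n; rewrite e.
  by exists n; rewrite e muln0.
by rewrite muln_eq0 => /orP[]/eqP; [left | right]; exists n.
Qed.

Lemma r_e_exists (X Y : codeType) (R : X * Y -> Prop) : r_e R -> r_e (fun x => exists y, R (x, y)).
Proof.
move=> [f Cf fP].
exists (fun p => f ((p.1, dec Y (fst_code p.2)), snd_code p.2)) => [|x].
  have CF : recursive (fun n => dec Y (fst_code n)).
    by apply: total_rec_ext (total_rec_fst (total_rec_var _)) => v; rewrite decK.
  have CS : recursive snd_code by exact/total_rec_snd/total_rec_var.
  by apply: recursive_comp Cf _; rec; [apply: recursive_comp CF _ | apply: recursive_comp CS _]; rec.
split=> [[y /fP[n fn]]|[n fn]].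
  by exists (pair_code (enc y, n)); rewrite /= fst_codeK snd_codeK encK.
by exists (dec Y (fst_code n)); apply/fP; exists (snd_code n).
Qed.

(** The search runs over codes of pairs made of a candidate [y] and a witness for [R (x, y)];
    totality of [R] ensures that it ends. *)
Lemma r_e_selection (X Y : codeType) (R : X * Y -> Prop) : r_e R -> (forall x, exists y, R (x, y)) ->
  exists2 g : X -> Y, recursive g & forall x, R (x, g x).
Proof.
move=> [f Cf fP] totR.
pose F x n := f ((x, dec Y (fst_code n)), snd_code n).
have exF x : exists n, F x n == 0.
  have [y /fP[n fn]] := totR x; exists (pair_code (enc y, n)).
  by rewrite /F fst_codeK snd_codeK encK fn.
pose m x := ex_minn (exF x); exists (fun x => dec Y (fst_code (m x))); last first.
  by move=> x; apply/fP; exists (snd_code (m x)); rewrite /m; case: ex_minnP => n /eqP.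
have Cm : recursive m.
  apply: (total_rec_min (F := fun w => F (dec X (tnth w ord_max)) (tnth w ord0))).
  + have C : recursive (fun p : X * nat => F p.1 p.2).
      have CF : recursive (fun n => dec Y (fst_code n)).
        by apply: total_rec_ext (total_rec_fst (total_rec_var _)) => v; rewrite decK.
      have CS : recursive snd_code by exact/total_rec_snd/total_rec_var.
      by apply: recursive_comp Cf _; rec;
        [apply: recursive_comp CF _ | apply: recursive_comp CS _]; rec.
    apply: total_rec_ext (total_rec_comp1 (f := fun n => let p := dec _ n in
        F p.1 p.2) C (total_rec_pair (total_rec_var ord_max) (total_rec_var ord0))) => w.
    by rewrite /= fst_codeK snd_codeK.
  + move=> v; rewrite (_ : ord_max = lift ord0 ord0) ?tnthS ?tnth0; last exact: val_inj.
    by rewrite -[enc _]/(m _) /m; case: ex_minnP => n /eqP.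
  + move=> v i; rewrite (_ : ord_max = lift ord0 ord0) ?tnthS ?tnth0; last exact: val_inj.
    rewrite -[enc _]/(m _) /m; case: ex_minnP => n _ min_n lt_in /eqP /min_n.
    by rewrite leqNgt lt_in.
by apply: total_rec_ext (total_rec_fst Cm) => v; rewrite decK.
Qed.

(** One witness per entry is gathered in a sequence, and the fold adds up the values that must all
    vanish. A witness list that is too short is read as continued by zeros, whence the padding in
    [gE]. *)
Lemma r_e_all (X Y : codeType) (d : Y) (R : X * Y -> Prop) (s : X -> seq Y) : r_e R -> recursive s ->
  r_e (fun x => forall i, i < size (s x) -> R (x, nth d (s x) i)).
Proof.
move=> [f Cf fP] Cs.
pose g (p : X * seq nat) := foldl (fun (z : seq nat * nat) y =>
  (behead z.1, z.2 + f ((p.1, y), head 0 z.1))) (p.2, 0) (s p.1).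
have Cg : recursive (fun p => (g p).2).
  apply: recursive_snd; apply: (recursive_foldl (g := fun q =>
    (behead q.2.1.1, q.2.1.2 + f ((q.1.1, q.2.2), head 0 q.2.1.1)))); rec.
  - by apply: recursive_comp Cs _; rec.
  - by apply: recursive_behead; rec.
  - apply: recursive_add; rec; apply: recursive_comp Cf _; rec.
    by apply: recursive_head; rec.
have gE p : ((g p).2 == 0) = all (fun yn => f ((p.1, yn.1), yn.2) == 0)
     (zip (s p.1) (p.2 ++ nseq (size (s p.1)) 0)).
  suff H z : ((foldl (fun (z : seq nat * nat) y =>
      (behead z.1, z.2 + f ((p.1, y), head 0 z.1))) z (s p.1)).2 == 0) =
    (z.2 == 0) && all (fun yn => f ((p.1, yn.1), yn.2) == 0)
     (zip (s p.1) (z.1 ++ nseq (size (s p.1)) 0)) by rewrite H.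
  elim: (s p.1) z => [|y t IHt] [u k] /=; first by case: u => [|? ?]; case: eqP.
  rewrite IHt /= addn_eq0 -andbA; congr andb.
  case: u => [|n u] //=; congr andb; congr all; elim: t u {IHt} => [|y' t IHt] [|n' u] //=; congr cons.
  - exact: (IHt [::]).
  - by have := IHt (rcons u 0); rewrite !cat_rcons.
have [h Ch hP] := r_e_exists (r_e_eq Cg (recursive_const _ 0)).
exists h => // x; rewrite -hP; split=> [Rx|[u /eqP]].
  have /choice[n nP] (i : nat) : exists n, i < size (s x) ->
      f ((x, nth d (s x) i), n) = 0.
    have [/Rx/fP[n fn]|_] := ltnP i (size (s x)); [by exists n | by exists 0].
  exists (mkseq n (size (s x))); apply/eqP; rewrite gE.
  apply/(all_nthP (d, 0)) => i lt_iz.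
  have lt_is : i < size (s x) by move: lt_iz; rewrite size_zip leq_min => /andP[].
  by rewrite nth_zip_cond lt_iz nth_cat size_mkseq lt_is nth_mkseq //= nP.
rewrite gE => /(all_nthP (d, 0)) H i lt_i; apply/fP.
exists (nth 0 (u ++ nseq (size (s x)) 0) i); have := H i.
have lt_iz : i < size (zip (s x) (u ++ nseq (size (s x)) 0)).
  by rewrite size_zip leq_min lt_i size_cat size_nseq ltn_addl.
by move=> /(_ lt_iz) /eqP; rewrite nth_zip_cond lt_iz.
Qed.

(** * A theorem of the alternative for integer lattices *)

Section Tucker.
Import Order.TTheory GRing.Theory Num.Theory.
Local Open Scope ring_scope.
Variables (F : realFieldType) (d : nat).
Implicit Types (a b u v y : 'rV[F]_d) (s : seq 'rV[F]_d).

Definition dot u v : F := (u *m v^T) 0 0.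

Lemma dotDl u v y : dot (u + v) y = dot u y + dot v y.
Proof. by rewrite /dot mulmxDl mxE. Qed.
Lemma dotZl c u y : dot (c *: u) y = c * dot u y.
Proof. by rewrite /dot -scalemxAl mxE. Qed.
Lemma dotDr u v y : dot y (u + v) = dot y u + dot y v.
Proof. by rewrite /dot linearD mulmxDr mxE. Qed.
Lemma dotZr c u y : dot y (c *: u) = c * dot y u.
Proof. by rewrite /dot linearZ -scalemxAr mxE. Qed.
Lemma dot0r y : dot y 0 = 0.
Proof. by rewrite /dot linear0 mulmx0 mxE. Qed.

Lemma dot_gt0 u : u != 0 -> 0 < dot u u.
Proof.
move=> u0; have ge0 i : 0 <= u 0 i * u^T i 0 by rewrite mxE -expr2 sqr_ge0.
rewrite /dot mxE lt_neqAle sumr_ge0 // andbT eq_sym; apply: contra u0.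
rewrite psumr_eq0 // => /allP u0; apply/eqP/rowP => i; rewrite mxE.
by have := u0 i; rewrite mem_index_enum mxE mulf_eq0 orbb => /(_ isT)/eqP.
Qed.

(** Tucker's form of linear programming duality, by induction on [s]. If the [y] found without [b]
    pairs negatively with [b], the other vectors are projected along [b] and the induction
    hypothesis is used a second time. *)
Lemma tucker_alternative a s : exists (c : F) (xs : seq F) y,
  [/\ size xs = size s, 0 <= c /\ all (>= 0) xs,
      c *: a + \sum_(p <- zip xs s) p.1 *: p.2 = 0,
      0 <= dot a y /\ all (fun v => 0 <= dot v y) s & 0 < c + dot a y].
Proof.
have [n] := ubnP (size s); elim: n a s => // n IHn a [|b s] lt_s.
  have [->|a0] := eqVneq a 0.
    exists 1, [::], 0; rewrite dot0r big_nil scaler0 addr0 addr0 ler01 ltr01.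
    by split.
  exists 0, [::], a; rewrite big_nil scale0r !add0r; have p := dot_gt0 a0.
  by split=> //; split=> //; apply: ltW.
have [c [xs [y [szxs [c0 xs0] rel [ay sy] pos]]]] := IHn a s lt_s.
have [by0|by0] := leP 0 (dot b y).
  exists c, (0 :: xs), y; rewrite /= szxs lexx xs0 by0 ay sy.
  by rewrite big_cons scale0r add0r.
(* [v + l v *: b] is the projection of [v] along [b] to the hyperplane orthogonal to [y]; [l v] is
   nonnegative since [dot b y] is negative, so a relation among projections expands to one with a
   nonnegative coefficient at [b]. *)
pose l v := - (dot v y) / dot b y.
have bN0 : dot b y != 0 by rewrite lt_eqF.
have ly v : dot (v + l v *: b) y = 0 by rewrite dotDl dotZl /l divfK // subrr.
have l0 v : 0 <= dot v y -> 0 <= l v.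
  by move=> vy; rewrite /l mulNr -mulrN mulr_ge0 // oppr_ge0 invr_le0 ltW.
have [|e [zs [u [szzs [e0 zs0] relz [au su] posz]]]] :=
  IHn (a + l a *: b) [seq v + l v *: b | v <- s]; first by rewrite size_map.
(* This correction makes [u + m *: y] orthogonal to [b] and lets it pair with [v] as [u] does with
   the projection of [v]. *)
pose m := - dot b u / dot b y.
have bz : dot b (u + m *: y) = 0 by rewrite dotDr dotZr /m divfK // subrr.
have vz v : dot v (u + m *: y) = dot (v + l v *: b) u.
  rewrite dotDl dotZl dotDr dotZr /m /l; field.
  exact: bN0.
exists e, (e * l a + \sum_(p <- zip zs s) p.1 * l p.2 :: zs), (u + m *: y).
rewrite /= szzs size_map bz lexx zs0 e0 !vz au posz andbT.
split=> //.
- split=> //; apply: addr_ge0; first by rewrite mulr_ge0 ?l0.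
  rewrite big_seq; apply: sumr_ge0 => -[z v] zv /=; apply: mulr_ge0.
    by apply: (allP zs0); have := map_f fst zv; rewrite -/unzip1 unzip1_zip // szzs size_map.
  by apply/l0/(allP sy); have := map_f snd zv; rewrite -/unzip2 unzip2_zip // szzs size_map.
- rewrite -[RHS]relz big_cons /= scalerDr scalerDl scalerA -!addrA; congr (_ + (_ + _)).
  have -> : zip zs [seq v + l v *: b | v <- s] = [seq (p.1, p.2 + l p.2 *: b) | p <- zip zs s].
    rewrite -[zs in LHS]map_id; elim: zs {szzs zs0 relz} s {lt_s szxs sy rel IHn su} => [|z zs IHz] [|v s] //=.
    by rewrite IHz.
  rewrite big_map /= scaler_suml; under [RHS]eq_bigr => p _ do rewrite scalerDr scalerA.
  by rewrite -big_split; apply: eq_bigr => p _; rewrite addrC.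
- split=> //; apply/allP => v vs /=; rewrite vz.
  by have := allP su _ (map_f (fun v => v + l v *: b) vs).
Qed.

End Tucker.

(** * Lattices of integer vectors *)

Section Lattice.
Import Order.TTheory GRing.Theory Num.Theory.
Local Open Scope ring_scope.

Lemma common_denominator (I : finType) (q : I -> rat) :
  exists2 N : nat, (0 < N)%N & exists z : I -> int, forall i, N%:R * q i = (z i)%:~R.
Proof.
exists (\prod_i `|denq (q i)|)%N; first by rewrite prodn_gt0 // => i; rewrite absz_gt0 denq_neq0.
exists (fun i => (\prod_(j | j != i) `|denq (q j)|)%N%:Z * numq (q i)) => i.
rewrite (bigD1 i) //= mulnC natrM intrM -mulrA; congr (_ * _).
by rewrite numqE mulrC -absz_denq.
Qed.

Lemma common_denominator_nat (I : finType) (q : I -> rat) : (forall i, 0 <= q i) ->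
  exists2 N : nat, (0 < N)%N & exists z : I -> nat, forall i, N%:R * q i = (z i)%:R.
Proof.
move=> q0; have [N N0 [z zE]] := common_denominator q; exists N => //.
exists (fun i => `|z i|%N) => i; rewrite zE -[in LHS](@gez0_abs (z i)) //.
by rewrite -(ler_int rat) -zE mulr_ge0.
Qed.

Lemma tucker_fin (F : realFieldType) (d : nat) (I : finType) (a : I -> 'rV[F]_d) j :
  exists (x : I -> F) y, [/\ forall i, 0 <= x i, \sum_i x i *: a i = 0,
    forall i, 0 <= dot (a i) y & 0 < x j + dot (a j) y].
Proof.
pose r := [seq i <- enum I | i != j].
have r_uniq : uniq r by rewrite filter_uniq ?enum_uniq.
have [c [xs [y [szxs [c0 xs0] rel [ay sy] pos]]]] := tucker_alternative (a j) (map a r).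
rewrite size_map in szxs.
pose x i := if i == j then c else nth 0 xs (index i r).
have in_r i : i != j -> i \in r by move=> ij; rewrite mem_filter ij mem_enum.
exists x, y; rewrite {3}/x eqxx; split=> // [i||i].
- rewrite /x; case: eqP => [//|/eqP/in_r ir].
  by apply: (allP xs0); rewrite mem_nth // szxs index_mem.
- rewrite (bigD1 j) //= {1}/x eqxx -[RHS]rel; congr (_ + _).
  have -> : xs = map x r.
    apply: (@eq_from_nth _ 0) => [|k lt_k]; first by rewrite size_map.
    have lt_kr : (k < size r)%N by rewrite -szxs.
    rewrite (nth_map j) // /x; have := mem_nth j lt_kr.
    by rewrite mem_filter => /andP[/negPf -> _]; rewrite index_uniq.
  by rewrite zip_map big_map big_filter big_enum_cond.
- case: (eqVneq i j) => [-> //|/in_r ir].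
  by apply: (allP sy); apply: map_f.
Qed.

Variables (n : nat) (K : 'rV[int]_n -> Prop).
Hypothesis K0 : K 0.
Hypothesis KB : forall e e', K e -> K e' -> K (e - e').

Local Notation toQ := (map_mx (intr : int -> rat)).

(** A finite family in [K] of maximal rank spans [K] rationally. It need not generate [K] over the
    integers, since denominators are cleared afterwards. *)
Lemma lattice_basis : exists m (B : 'M[int]_(m, n)),
  (forall i, K (row i B)) /\ forall e, K e -> (toQ e <= toQ B)%MS.
Proof.
pose P r := `[< exists m (B : 'M[int]_(m, n)),
  (forall i, K (row i B)) /\ \rank (toQ B) = r >].
have exP : exists r, P r.
  by exists (\rank (toQ (0 : 'M_(0, n)))); apply/asboolP; exists 0%N, 0; split=> // -[].
have boundP r : P r -> (r <= n)%N by move=> /asboolP[m [B [_ <-]]]; apply: rank_leq_col.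
case: (ex_maxnP exP boundP) => r /asboolP[m [B [KBr rB]]] maxr.
exists m, B; split=> // e Ke.
have le_r : (\rank (toQ e + toQ B)%MS <= \rank (toQ B))%N.
  rewrite rB; apply: maxr; apply/asboolP; exists (1 + m)%N, (col_mx e B); split.
    move=> i; rewrite -(splitK i); case: (split i) => k /=; rewrite ?rowKu ?rowKd //.
    by rewrite (_ : row k e = e) //; apply/rowP => l; rewrite mxE ord1.
  by rewrite map_col_mx (addsmxE (toQ e) (toQ B)).
apply: submx_trans (addsmxSl _ (toQ B)) _.
by rewrite -(geq_leqif (mxrank_leqif_sup (addsmxSr _ _))).
Qed.

Lemma lattice_scale e k : K e -> K (e *+ k).
Proof.
move=> Ke; elim: k => [|k IHk]; first by rewrite mulr0n.
by rewrite mulrSr -[e in X in _ + X]opprK; apply: KB => //; rewrite -sub0r; apply: KB.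
Qed.

Lemma lattice_comb m (B : 'M[int]_(m, n)) (x : 'rV[int]_m) :
  (forall i, K (row i B)) -> K (x *m B).
Proof.
have KN e : K e -> K (- e) by move=> Ke; rewrite -sub0r; apply: KB.
move=> KBr; rewrite mulmx_sum_row.
apply: (big_ind K) => // [e e' Ke Ke'|i _]; first by rewrite -[e']opprK; apply/KB/KN.
case: (x 0 i) => k; rewrite ?NegzE ?scaleNr; [|apply: KN];
  by rewrite -natz scaler_nat; apply: lattice_scale.
Qed.

(** Duality is applied in the rational quotient by the span of [K]: a nonnegative relation there is
    a nonnegative vector of the span, and a linear form there is a form vanishing on [K]. Multiples
    by a common denominator are integral. *)
Lemma lattice_alternative (j : 'I_n) :
  (exists2 e, K e & (forall i, 0 <= e 0 i) /\ 0 < e 0 j) \/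
  (exists2 f : 'I_n -> nat, (0 < f j)%N &
     forall e, K e -> \sum_i e 0 i * (f i)%:Z = 0).
Proof.
have [m [B [KBr spanB]]] := lattice_basis.
(* Row [i] of [C] represents the image of the [i]-th basis vector in the quotient by the span of
   [B]. *)
pose C := cokermx (toQ B).
have [x [y [x0 rel y0 pos]]] := tucker_fin (fun i => row i C) j.
have [xj|xj] := ltP 0 (x j); [left | right].
  have /submxP[D xE] : (\row_i x i <= toQ B)%MS.
    rewrite submxE mulmx_sum_row -[X in _ == X]rel; apply/eqP/eq_bigr => i _.
    by rewrite mxE.
  have [N N0 [z zE]] := common_denominator (fun i => D 0 i).
  have eE i : ((\row_i z i *m B) 0 i)%:~R = N%:R * x i.
    have -> : x i = (D *m toQ B) 0 i by rewrite -xE mxE.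
    rewrite !mxE mulr_sumr rmorph_sum; apply: eq_bigr => k _.
    by rewrite !mxE rmorphM /= -zE mulrA.
  exists (\row_i z i *m B); first exact: lattice_comb.
  by split=> [i|]; rewrite -(ltr_int rat, ler_int rat) eE ?mulr_ge0 ?mulr_gt0 ?ltr0n.
have yj : 0 < dot (row j C) y by move: pos; apply: contraTT; rewrite -!leNgt => h; lra.
have [N N0 [f fE]] := common_denominator_nat y0.
exists f; first by rewrite -(ltr_nat rat) -fE mulr_gt0 ?ltr0n.
move=> e Ke; apply/eqP; rewrite -(intr_eq0 rat); apply/eqP.
transitivity (N%:R * (toQ e *m C *m y^T) 0 0).
  rewrite -mulmxA mxE mulr_sumr rmorph_sum; apply: eq_bigr => i _.
  rewrite rmorphM /= mxE mulrCA -[(f i)%:Z%:~R]/((f i)%:R) -fE /dot.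
  by congr (_ * (_ * _)); rewrite -row_mul mxE.
have := spanB e Ke; rewrite submxE => /eqP ->.
by rewrite mul0mx mxE mulr0.
Qed.

End Lattice.

(** * Saturation of submonoids of nilpotent groups *)

Local Open Scope classical_set_scope.
Local Open Scope group_scope.
Local Open Scope quotient_scope.

Section SubgroupLemmas.
Variable G : groupType.
Implicit Types (S A N D : set G) (x y z : G).
Local Notation L := (@lower_central G).

Definition normal_subgroup N := subgroup N /\ forall x y, N x -> N (x ^ y).

Lemma subgroup1 S : subgroup S -> S 1. Proof. by case=> -[]. Qed.
Lemma subgroupM S x y : subgroup S -> S x -> S y -> S (x * y).
Proof. by case=> -[_ mS] _; apply: mS. Qed.
Lemma subgroupV S x : subgroup S -> S x -> S x^-1.
Proof. by case=> _; apply. Qed.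
Lemma subgroupX S x n : subgroup S -> S x -> S (x ^+ n).
Proof.
move=> sS Sx; elim: n => [|n IHn]; first exact: subgroup1.
by rewrite expgS; apply: subgroupM.
Qed.

Lemma submonoidX S x n : submonoid S -> S x -> S (x ^+ n).
Proof.
move=> [S1 SM] Sx; elim: n => [|n IHn]; first exact: S1.
by rewrite expgS; apply: SM.
Qed.

Lemma mem_subgroup_gen A : A `<=` subgroup_gen A.
Proof. exact: sub_gen_smallest. Qed.

Lemma subgroup_gen_min A S : subgroup S -> A `<=` S -> subgroup_gen A `<=` S.
Proof. exact: smallest_sub. Qed.

Lemma subgroup_gen_subgroup A : subgroup (subgroup_gen A).
Proof.
split; first split.
- by move=> S [[[S1 _] _] _].
- by move=> x y Ax Ay S sAS; apply: subgroupM (sAS.1) _ _; [apply: Ax | apply: Ay].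
- by move=> x Ax S sAS; apply: subgroupV (sAS.1) _; apply: Ax.
Qed.

Lemma mem_monoid_gen A : A `<=` monoid_gen A.
Proof. exact: sub_gen_smallest. Qed.

Lemma monoid_gen_min A S : submonoid S -> A `<=` S -> monoid_gen A `<=` S.
Proof. exact: smallest_sub. Qed.

Lemma monoid_gen_submonoid A : submonoid (monoid_gen A).
Proof.
split; first by move=> S [[S1 _] _].
by move=> x y Ax Ay S sAS; apply: (sAS.1.2); [apply: Ax | apply: Ay].
Qed.

Lemma subgroupJ S x y : subgroup S -> S x -> S y -> S (x ^ y).
Proof. by move=> sS Sx Sy; apply: subgroupM (subgroupM _ _ _) => //; apply: subgroupV. Qed.

Lemma lower_central_normal n : normal_subgroup (L n).
Proof.
elim: n => [|n [sL nL]] //=; split; first exact: subgroup_gen_subgroup.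
move=> x y Lx; set K := subgroup_gen _ in Lx *.
have sK : subgroup K by apply: subgroup_gen_subgroup.
have: K `<=` [set z | K (z ^ y)]; last exact.
apply: subgroup_gen_min => [|_ [z Lz [t _ <-]]].
  split; first split; rewrite /=.
  - by rewrite conj1g; apply: subgroup1 sK.
  - by move=> z t /= Kz Kt; rewrite /= conjMg; apply: (subgroupM sK).
  - by move=> z /= Kz; rewrite conjVg; apply: (subgroupV sK).
rewrite /= conjRg; apply: mem_subgroup_gen; exists (z ^ y); first exact: nL.
by exists (t ^ y).
Qed.

Lemma lower_central_subgroup n : subgroup (L n).
Proof. by case: (lower_central_normal n). Qed.

Lemma lower_centralR n x y : L n x -> L n.+1 [~ x, y].
Proof. by move=> Lx; apply: mem_subgroup_gen; exists x => //; exists y. Qed.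

Lemma lower_centralS n : L n.+1 `<=` L n.
Proof.
have [sL nL] := lower_central_normal n.
apply: subgroup_gen_min => // _ [x Lx [y _ <-]].
by rewrite commgEl; apply: subgroupM (subgroupV _ _) (nL _ _ _).
Qed.

Lemma lower_central_between n D :
  subgroup D -> L n.+1 `<=` D -> D `<=` L n ->
  normal_subgroup D.
Proof.
move=> sD LD DL; split=> // x y Dx.
rewrite -(mulVKg x (x ^ y)) -commgEl; apply: subgroupM => //.
by apply: LD; apply: lower_centralR; apply: DL.
Qed.

(** The factor of [L n] by the next term is finitely generated, stated without quotients. Modulo
    [L n.+2], commutators of [L n] with the group are multiplicative in each argument, so
    commutators of generators suffice. *)
Lemma lower_central_fg (X : seq G) n : subgroup_gen [set` X] = [set: G] ->
  exists2 S : seq G, [set` S] `<=` L n &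
    forall D, subgroup D -> [set` S] `<=` D -> L n.+1 `<=` D ->
      L n `<=` D.
Proof.
move=> genX; elim: n => [|n [S SL genS]].
  by exists X => //= D sD XD _; rewrite -genX; apply: subgroup_gen_min.
exists [seq [~ s, x] | s <- S, x <- X].
  by move=> _ /= /allpairsP[[s x] /= [sS _ ->]]; by apply: lower_centralR; apply: SL.
move=> D0 sD0 SD0 LD0.
(* Cutting down to [L n.+1] places the subgroup between two consecutive terms, which makes it
   normal. *)
pose D := D0 `&` L n.+1.
have sL := lower_central_subgroup.
have sD : subgroup D.
  split; first split; first by split; [apply: subgroup1 | apply: subgroup1 (sL _)].
  - by move=> x y [? ?] [? ?]; split; [apply: subgroupM | apply: subgroupM (sL _) _ _].
  - by move=> x [? ?]; split; [apply: subgroupV | apply: subgroupV (sL _) _].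
have LD : L n.+2 `<=` D.
  by move=> x Lx; split; [apply: LD0 | apply: lower_centralS].
have SD : [set` [seq [~ s, x] | s <- S, x <- X]] `<=` D.
  move=> y Sy; split; first exact: SD0.
  by case/allpairsP: Sy => -[s x] /= [sS _ ->]; by apply: lower_centralR; apply: SL.
have [_ nD] : normal_subgroup D by apply: (@lower_central_between n.+1) => // x [].
suff: L n.+1 `<=` D by move=> LD' x /LD'[].
have sub_right s : subgroup [set y | D [~ s, y]].
  split; first split; rewrite /=.
  - by rewrite commg1; apply: subgroup1.
  - move=> x y /= Dx Dy; suff -> : [~ s, x * y] = [~ s, y] * [~ s, x] ^ y.
      by apply: subgroupM => //; apply: nD.
    by rewrite !commgEl conjMg conjVg -mulgA mulVKg conjgM.
  - move=> x /= Dx; suff -> : [~ s, x^-1] = [~ s, x]^-1 ^ x^-1.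
      by apply: nD; apply: subgroupV.
    by rewrite invgR (commgEl s) (commgEr x) conjMg conjgK.
apply: subgroup_gen_min => // _ [x Lx [y _ <-]].
suff {x Lx}/(_ x Lx) : L n `<=` [set x | forall y, D [~ x, y]] by apply.
apply: genS.
- split; first split; rewrite /=.
  + by move=> z; rewrite comm1g; apply: subgroup1.
  + move=> a b /= Da Db z; suff -> : [~ a * b, z] = [~ a, z] ^ b * [~ b, z].
      by apply: subgroupM => //; apply: nD.
    by rewrite !commgEr conjMg -conjgM (conjVg z b) -[RHS]mulgA mulVKg.
  + move=> a /= Da z; suff -> : [~ a^-1, z] = ([~ a, z]^-1) ^ a^-1.
      by apply: nD; apply: subgroupV.
    by rewrite invgR (commgEr a^-1) (commgEl z) conjMg conjgK.
- move=> s sS z; suff: subgroup_gen [set` X] `<=` [set y | D [~ s, y]].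
    by rewrite genX; apply.
  apply: subgroup_gen_min => // x xX /=; apply: SD; apply/allpairsP.
  by exists (s, x).
- by move=> x Lx z; apply: LD; apply: lower_centralR.
Qed.

End SubgroupLemmas.

Lemma commXXg (G : groupType) (x y : G) n :
  commute [~ x, y] x -> commute [~ x, y] y ->
  [~ x ^+ n, y ^+ n] = [~ x, y] ^+ (n * n).
Proof.
move=> cx cy; set c := [~ x, y] in cx cy *.
have xJ : x ^ y = x * c by rewrite /c commgEl mulVKg.
have cJ k : (c ^+ k) ^ y = c ^+ k.
  by rewrite conjXg conjgE cy mulKg.
suff xnJ m : (x ^+ n) ^ (y ^+ m) = x ^+ n * c ^+ (n * m).
  by rewrite commgEl xnJ mulKg.
elim: m => [|m IHm]; first by rewrite conjg1 muln0 mulg1.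
rewrite expgSr conjgM IHm conjMg cJ conjXg xJ expgMn; last exact: commute_sym.
by rewrite -mulgA -expgnDr mulnS.
Qed.

(** * Saturation along a central subgroup generated by commutators *)

Section Saturation.
Variables (G : groupType) (M Z X : set G) (S : seq G).
Hypothesis mM : submonoid M.
Hypothesis sZ : subgroup Z.
Hypothesis cZ : forall z q, Z z -> commute z q.
Hypothesis MZ : forall q, exists2 m, M m & exists2 z, Z z & q = m * z.
Hypothesis XZ : forall x y, X x -> Z [~ x, y].
Hypothesis genX : forall D, subgroup D -> (forall x y, X x -> D [~ x, y]) -> Z `<=` D.
Hypothesis SZ : [set` S] `<=` Z.
Hypothesis genS : forall D, subgroup D -> [set` S] `<=` D -> Z `<=` D.

(* [c] and [c^-1] are reached from [M] up to an error that is linear in [n]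
   while the power of [c] is quadratic. *)
Let dominated u c := exists d, forall n,
  M (u ^+ (d * n) * c ^+ (n * n)) /\ M (u ^+ (d * n) * c ^- (n * n)).

Let dominated_mono u v c : Z u -> M v -> dominated u c -> dominated (u * v) c.
Proof.
move=> Zu Mv [d dP]; exists d => n; have [M1 M2] := dP n.
have Mvn := submonoidX (d * n) mM Mv.
rewrite expgMn; last exact: cZ.
rewrite (commuteX2 (d * n) (d * n) (cZ v Zu)) -!mulgA.
by split; apply: mM.2.
Qed.

(** The constants [d] add up under products, and the presence of both signs in [dominated] gives
    inverses. *)
Let dominated_subgroup u : Z u -> subgroup (Z `&` dominated u).
Proof.
move=> Zu; split; first split.
- split; first exact: subgroup1.
  by exists 0 => n; rewrite mul0n expg1n invg1 mulg1; split; apply: mM.1.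
- move=> a b [Za [d dP]] [Zb [e eP]]; split; first exact: subgroupM.
  exists (d + e) => n; have [[M1 M2] [M3 M4]] := (dP n, eP n).
  have E c c' : Z c -> u ^+ ((d + e) * n) * (c * c') =
      (u ^+ (d * n) * c) * (u ^+ (e * n) * c').
    move=> Zc; rewrite mulnDl expgnDr -!mulgA; congr (_ * _).
    by rewrite !mulgA (cZ _ Zc).
  have cab := cZ b Za; rewrite expgMn // (commuteX2 (n * n) (n * n) cab) invgM.
  rewrite -(commuteX2 (n * n) (n * n) cab) !E; last 2 first.
  + exact: subgroupV sZ (subgroupX _ sZ Za).
  + exact: subgroupX.
  by split; apply: mM.2.
- move=> a [Za [d dP]]; split; first exact: subgroupV.
  by exists d => n; have [M1 M2] := dP n; rewrite expVgn invgK.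
Qed.

Let quasi_inverse m : M m -> exists2 m', M m' & exists2 z, Z z & m' = m^-1 * z.
Proof.
move=> Mm; have [m' Mm' [z Zz e]] := MZ m^-1; exists m' => //.
by exists z^-1; [apply: subgroupV | rewrite e mulgK].
Qed.

(** A commutator depends only on the classes of its entries modulo the central subgroup [Z], and [M]
    meets every class. *)
Let commutator_rep x y : exists m p, [/\ M m, M p & [~ x, y] = [~ m, p]].
Proof.
have [m Mm [z Zz ->]] := MZ x; have [p Mp [t Zt ->]] := MZ y.
exists m, p; split=> //.
have tJ q : q ^ t = q by rewrite conjgE -(cZ q Zt) mulKg.
have zJ q : z ^ q = z by rewrite conjgE (cZ q Zz) mulKg.
rewrite !commgEl conjMg zJ conjgM tJ invgM.
by rewrite -(cZ _ Zz) (cZ _ (subgroupV sZ Zz)) -mulgA mulKg.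
Qed.

Let commutator_dominated x y : X x ->
  exists2 u, M u /\ Z u & dominated u [~ x, y].
Proof.
move=> Xx; have [m [p [Mm Mp e]]] := commutator_rep x y.
have Zc := XZ y Xx; rewrite {x Xx y}e in Zc *.
have [m' Mm' [z Zz em]] := quasi_inverse Mm.
have [p' Mp' [t Zt ep]] := quasi_inverse Mp.
have zE : z = m * m' by rewrite em mulVKg.
have tE : t = p * p' by rewrite ep mulVKg.
(* [z] and [t] are the defects of [m'] and [p'] as inverses of [m] and [p]; [key] costs exactly
   their [n]-th powers, so [d = 1]. *)
exists (z * t).
  by split; [rewrite zE tE; do !apply: mM.2 | apply: subgroupM].
exists 1%N => n; rewrite mul1n expgMn; last exact: cZ.
have Zzn : Z (z ^+ n) by apply: subgroupX.
have Ztn : Z (t ^+ n) by apply: subgroupX.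
have En : m' ^+ n = m ^- n * z ^+ n.
  by rewrite em expgMn ?expVgn //; apply: commute_sym; apply: cZ.
have Fn : p' ^+ n = p ^- n * t ^+ n.
  by rewrite ep expgMn ?expVgn //; apply: commute_sym; apply: cZ.
have cXX a b : Z [~ a, b] -> [~ a, b] ^+ (n * n) = [~ a ^+ n, b ^+ n].
  by move=> Zab; rewrite commXXg //; apply: cZ.
(* Used for [(m, p)] and for [(p, m)]; the swapped commutator provides the negative power. *)
have key a b a' b' w v : Z w -> Z v -> Z [~ a, b] -> a' ^+ n = a ^- n * w ->
    b' ^+ n = b ^- n * v -> w * v * [~ a, b] ^+ (n * n) = a' ^+ n * b' ^+ n * (a ^+ n * b ^+ n).
  move=> Zw Zv Zab -> ->; rewrite cXX //.
  rewrite -(cZ (a ^- n) Zw) -(cZ (b ^- n) Zv) -!mulgA (mulgA (a ^- n) v).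
  by rewrite -(cZ (a ^- n) Zv) -!mulgA.
split.
  rewrite (key _ _ m' p') //; do !apply: mM.2 => //; exact: submonoidX.
have Zc' : Z [~ p, m] by rewrite -invgR; apply: subgroupV.
rewrite -expVgn invgR (cZ _ Zzn) (key _ _ p' m') //; do !apply: mM.2 => //; exact: submonoidX.
Qed.

(** Each commutator has its own [u], and products are dominated by the product of these. Finite
    generation of [Z] makes one [u] serve everywhere, as is required for applying domination to
    [z * u], which involves [u] itself. *)
Let dominated_all : exists2 u, M u /\ Z u & Z `<=` dominated u.
Proof.
have Z_dom c : Z c -> exists2 u, M u /\ Z u & dominated u c.
  pose D c := Z c /\ exists2 u, M u /\ Z u & dominated u c.
  suff ZD : Z `<=` D by move=> /ZD[].
  apply: genX => [|x y Xx]; last by split; [apply: XZ | apply: commutator_dominated].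
  have sdom u := dominated_subgroup (u := u).
  split; first split.
  - split; [exact: subgroup1 | exists 1; first by split; [apply: mM.1|apply: subgroup1]].
    by case: (subgroup1 (sdom 1 (subgroup1 sZ))).
  - move=> a b [Za [u [Mu Zu] ua]] [Zb [v [Mv Zv] vb]]; split; first exact: subgroupM.
    exists (u * v); first by split; [apply: mM.2 | apply: subgroupM].
    have Zuv : Z (u * v) by apply: subgroupM.
    have [||_ //] := @subgroupM _ _ a b (sdom _ Zuv); split=> //.
      exact: dominated_mono.
    by rewrite (cZ _ Zu); apply: dominated_mono.
  - move=> a [Za [u [Mu Zu] ua]]; split; first exact: subgroupV.
    exists u => //.
    by have [|_ //] := @subgroupV _ _ a (sdom _ Zu); split.
suff [u MZu Su] : exists2 u, M u /\ Z u & [set` S] `<=` dominated u.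
  exists u => //; move: MZu => [Mu Zu].
  suff: Z `<=` Z `&` dominated u by move=> ZD z /ZD[].
  apply: genS; first exact: dominated_subgroup.
  by move=> s Ss; split; [apply: SZ | apply: Su].
elim: S SZ => [|s T IHT] sSZ; first by exists 1; [split; [apply: mM.1|apply: subgroup1]|].
have [|u [Mu Zu] uT] := IHT; first by move=> t /= tT; apply: sSZ; rewrite /= inE tT orbT.
have [|v [Mv Zv] vs] := Z_dom s; first by apply: sSZ; rewrite /= inE eqxx.
exists (u * v); first by split; [apply: mM.2 | apply: subgroupM].
move=> t /=; rewrite inE => /orP[/eqP->|/uT]; last exact: dominated_mono.
by rewrite (cZ _ Zu); apply: dominated_mono.
Qed.

(** Once central elements of [M] have their inverses in [M], quasi-inverses can be corrected to
    inverses. Then [M] is a subgroup, and it contains the commutators generating [Z], as these have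
    entries in [M]. *)
Lemma central_commutators_sub : Z `<=` M.
Proof.
have [u [Mu Zu] domu] := dominated_all.
have invP z : M z -> Z z -> M z^-1.
  move=> Mz Zz; have Zv : Z (z * u) by apply: subgroupM.
  (* For [n = d.+1] the square exceeds [d * n] by [n]. So [M] contains [u ^- d.+1 * z ^- k], and
     multiplying by [u ^+ d.+1 * z ^+ k.-1], also in [M], leaves [z^-1]. *)
  have [d dP] := domu _ Zv; have [_] := dP d.+1.
  set k := (d.+1 * d.+1)%N; set j := (d * d.+1)%N.
  have kE : k = (j + d.+1)%N by rewrite /k mulSn addnC.
  rewrite expgMn; last exact: cZ.
  rewrite invgM => Mj.
  have -> : z^-1 = (u ^+ j * (u ^- k * z ^- k)) * (u ^+ d.+1 * z ^+ k.-1).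
    have Zuk : Z (u ^+ d.+1) by apply: subgroupX.
    transitivity (u ^+ j * (u ^- k * u ^+ d.+1) * (z ^- k * z ^+ k.-1)); last first.
      rewrite -!mulgA; congr (_ * (_ * _)).
      by rewrite !mulgA (cZ (z ^- k) Zuk).
    have -> : z ^- k * z ^+ k.-1 = z^-1 by rewrite -(@prednK k) // expgSr invgM mulgVK.
    by rewrite kE addnC expgnDr invgM mulgVK mulgV mul1g.
  by do !apply: mM.2 => //; apply: submonoidX.
have invM m : M m -> M m^-1.
  move=> Mm; have [m' Mm' [z Zz em]] := quasi_inverse Mm.
  have Mz : M z by rewrite -(mulVKg m z) -em; apply: mM.2.
  by rewrite -(mulgK z m^-1) -em; apply: mM.2 => //; apply: invP.
have sM : subgroup M by split.
apply: genX => // x y Xx; have [m [p [Mm Mp ->]]] := commutator_rep x y.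
by rewrite commgEl; apply: subgroupM (subgroupV _ _) (subgroupJ _ _ _).
Qed.

End Saturation.

(** * Quotient groups *)

Section Quotient.
Variables (G : groupType) (N : set G) (nN : normal_subgroup N).

Definition same_coset : rel G := fun x y => `[< N (x^-1 * y) >].

Fact same_coset_refl : reflexive same_coset.
Proof. by move=> x; apply/asboolP; rewrite mulVg; apply: subgroup1 nN.1. Qed.

Fact same_coset_sym : symmetric same_coset.
Proof.
suff H x y : same_coset x y -> same_coset y x by move=> x y; apply/idP/idP; apply: H.
move=> /asboolP Nxy; apply/asboolP.
by rewrite -[x]invgK -invgM; apply: subgroupV nN.1 _.
Qed.

Fact same_coset_trans : transitive same_coset.
Proof.
move=> y x z /asboolP Nxy /asboolP Nyz; apply/asboolP.
by rewrite -(mulVKg y z) mulgA; apply: subgroupM nN.1 _ _.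
Qed.

Canonical same_coset_equiv :=
  EquivRel same_coset same_coset_refl same_coset_sym same_coset_trans.

Definition quotient := {eq_quot same_coset_equiv}.
HB.instance Definition _ := Choice.on quotient.

Definition quotient_pi (x : G) : quotient := \pi_{eq_quot same_coset_equiv} x.

Lemma quotient_piE x y : quotient_pi x = quotient_pi y <-> N (x^-1 * y).
Proof.
rewrite /quotient_pi; split=> [/eqP|Nxy]; last apply/eqP.
  by rewrite eqmodE => /asboolP.
by rewrite eqmodE; apply/asboolP.
Qed.

Lemma quotient_pi_surj (q : quotient) : exists x, q = quotient_pi x.
Proof. by exists (repr q); rewrite /quotient_pi reprK. Qed.

Lemma repr_quotient_pi x : N (x^-1 * repr (quotient_pi x)).
Proof. by apply/quotient_piE; rewrite /quotient_pi reprK. Qed.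

Let mulq (q r : quotient) := quotient_pi (repr q * repr r).
Let invq (q : quotient) := quotient_pi (repr q)^-1.

Let mulq_pi x y : mulq (quotient_pi x) (quotient_pi y) = quotient_pi (x * y).
Proof.
apply/esym/quotient_piE; rewrite invgM.
have -> : y^-1 * x^-1 * (repr (quotient_pi x) * repr (quotient_pi y)) =
  (x^-1 * repr (quotient_pi x)) ^ y * (y^-1 * repr (quotient_pi y)).
  by rewrite conjgE -!mulgA mulVKg.
by apply: subgroupM nN.1 _ (repr_quotient_pi _); apply: nN.2; apply: repr_quotient_pi.
Qed.

Let invq_pi x : invq (quotient_pi x) = quotient_pi x^-1.
Proof.
apply/quotient_piE; rewrite invgK.
have := nN.2 _ x^-1 (repr_quotient_pi x).
by rewrite conjgE invgK -mulgA mulVKg.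
Qed.

Let mulqA : associative mulq.
Proof.
move=> q r s; have [[x ->] [y ->] [z ->]] := And3 (quotient_pi_surj q)
  (quotient_pi_surj r) (quotient_pi_surj s).
by rewrite !mulq_pi mulgA.
Qed.

Let mul1q : left_id (quotient_pi 1) mulq.
Proof. by move=> q; have [x ->] := quotient_pi_surj q; rewrite mulq_pi mul1g. Qed.
Let mulq1 : right_id (quotient_pi 1) mulq.
Proof. by move=> q; have [x ->] := quotient_pi_surj q; rewrite mulq_pi mulg1. Qed.
Let mulVq : left_inverse (quotient_pi 1) invq mulq.
Proof. by move=> q; have [x ->] := quotient_pi_surj q; rewrite invq_pi mulq_pi mulVg. Qed.
Let mulqV : right_inverse (quotient_pi 1) invq mulq.
Proof. by move=> q; have [x ->] := quotient_pi_surj q; rewrite invq_pi mulq_pi mulgV. Qed.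

HB.instance Definition _ := isGroup.Build quotient mulqA mul1q mulq1 mulVq mulqV.

Lemma quotient_piM x y : quotient_pi (x * y) = quotient_pi x * quotient_pi y.
Proof. by rewrite -mulq_pi. Qed.
Lemma quotient_pi1 : quotient_pi 1 = 1.
Proof. by []. Qed.
Lemma quotient_piV x : quotient_pi x^-1 = (quotient_pi x)^-1.
Proof. by rewrite -invq_pi. Qed.
Lemma quotient_piR x y : quotient_pi [~ x, y] = [~ quotient_pi x, quotient_pi y].
Proof. by rewrite /commg /conjg !quotient_piM !quotient_piV. Qed.

End Quotient.

Lemma subgroup_preim (G H : groupType) (f : G -> H) (D : set H) :
  {morph f : x y / x * y} -> f 1 = 1 -> {morph f : x / x^-1} ->
  subgroup D -> subgroup [set x | D (f x)].
Proof.
move=> fM f1 fV sD; split; first split; rewrite /=.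
- by rewrite f1; apply: subgroup1 sD.
- by move=> x y /= Dx Dy; rewrite fM; apply: (subgroupM sD).
- by move=> x /= Dx; rewrite fV; apply: (subgroupV sD).
Qed.

(** Modulo [lower_central i.+2], the term [lower_central i.+1] is central, finitely generated, and
    generated by commutators with entries in [lower_central i]; the saturation step is applied in
    that quotient. *)
Lemma lower_central_absorb (G : groupType) (X : seq G) (M : set G) i :
  subgroup_gen [set` X] = [set: G] -> submonoid M ->
  (forall g, exists2 m, M m & exists2 l, lower_central i.+1 l & g = m * l) ->
  lower_central i.+2 `<=` M -> lower_central i.+1 `<=` M.
Proof.
move=> genX mM ML LM.
have nN := lower_central_normal G i.+2; pose pi := quotient_pi nN.
have piE := quotient_piE nN; have piR := quotient_piR nN.
have [S SL genS] := lower_central_fg i.+1 genX.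
have sD D : subgroup D -> subgroup [set x | D (pi x)].
  by apply: subgroup_preim; [exact: quotient_piM|exact: quotient_pi1|exact: quotient_piV].
have sL := lower_central_subgroup G i.+1.
pose Mq := [set q | exists2 m, M m & q = pi m].
suff H : [set q | exists2 l, lower_central i.+1 l & q = pi l] `<=` Mq.
  move=> l Ll; have [m Mm /esym/piE Nml] := H (pi l) (ex_intro2 _ _ l Ll erefl).
  by rewrite -(mulVKg m l); apply: mM.2 => //; apply: LM.
apply: (@central_commutators_sub _ Mq _
    [set q | exists2 x, lower_central i x & q = pi x] (map pi S)).
- split; first by exists 1; [apply: mM.1 | rewrite -quotient_pi1].
  move=> _ _ [x Mx ->] [y My ->]; exists (x * y); first exact: mM.2.
  by rewrite -quotient_piM.
- split; first split.
  + by exists 1; [apply: subgroup1 sL | rewrite -quotient_pi1].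
  + move=> _ _ [x Mx ->] [y My ->]; exists (x * y); first exact: subgroupM sL _ _.
    by rewrite -quotient_piM.
  + move=> _ [x Mx ->]; exists x^-1; first exact: subgroupV sL _.
    by rewrite -quotient_piV.
- move=> _ q [l Ll ->]; have [x ->] := quotient_pi_surj q.
  rewrite /commute -!quotient_piM; apply/esym/piE; rewrite invgM -mulgA.
  exact: (lower_centralR x Ll).
- move=> q; have [x ->] := quotient_pi_surj q; have [m Mm [l Ll ->]] := ML x.
  exists (pi m); first by exists m.
  by exists (pi l); [exists l | rewrite -quotient_piM].
- move=> _ q [x Lx ->]; have [y ->] := quotient_pi_surj q.
  by exists [~ x, y]; [apply: lower_centralR | rewrite -piR].
- move=> D sDD DR q [l Ll ->]; suff: lower_central i.+1 `<=` [set x | D (pi x)] by apply.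
  apply: subgroup_gen_min; first exact: sD.
  by move=> _ [x Lx [y _ <-]]; rewrite /= /pi piR; apply: DR; exists x.
- by move=> _ /= /mapP[s sS ->]; exists s => //; apply: SL.
- move=> D sDD SD q [l Ll ->]; suff: lower_central i.+1 `<=` [set x | D (pi x)] by apply.
  apply: genS; first exact: sD.
  + by move=> s sS; apply: SD => /=; apply: map_f.
  + move=> x Nx; rewrite /= (_ : pi x = 1); first exact: subgroup1 sDD.
    by rewrite -(quotient_pi1 nN); apply/esym/piE; rewrite invg1 mul1g.
Qed.

Lemma submonoid_mul_normal (G : groupType) (M N : set G) :
  submonoid M -> normal_subgroup N ->
  submonoid [set g | exists2 m, M m & exists2 l, N l & g = m * l].
Proof.
move=> mM [sN nN]; split.
  by exists 1; [apply: mM.1 | exists 1; [apply: subgroup1 sN | rewrite mulg1]].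
move=> _ _ [m Mm [l Ll ->]] [p Mp [k Lk ->]]; exists (m * p); first exact: mM.2.
exists (l ^ p * k); first by apply: (subgroupM sN) => //; apply: nN.
by rewrite -!(mulgA m) (mulgA l p) (conjgC l p) -(mulgA p).
Qed.

Lemma nilpotent_saturation (G : groupType) (X : seq G) (M : set G) :
  nilpotent_group G -> subgroup_gen [set` X] = [set: G] -> submonoid M ->
  (forall g, exists2 m, M m & exists2 l, lower_central 1 l & g = m * l) ->
  forall g, M g.
Proof.
move=> [n Ln] genX mM ML.
(* Raising the index by one lets the induction start at [lower_central 1], where [ML] concludes,
   even when [n = 0]. *)
have : lower_central n.+1 `<=` M.
  by move=> x /lower_centralS; rewrite Ln => ->; apply: mM.1.
elim: n M mM ML {Ln} => [|i IHi] M mM ML LM g.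
  by have [m Mm [l /LM Ml ->]] := ML g; apply: mM.2.
(* The induction hypothesis is used twice: for [M], once it contains [lower_central i.+1], and, to
   obtain that, for the product of [M] with [lower_central i.+1]. *)
apply: (IHi M) => //; apply: (lower_central_absorb genX mM _ LM) => {}g.
have [sL nL] := lower_central_normal G i.+1.
apply: (IHi (fun x => exists2 m, M m & exists2 l, lower_central i.+1 l & x = m * l)).
- exact: submonoid_mul_normal mM (conj sL nL).
- move=> h; have [m Mm [l Ll ->]] := ML h; exists m; last by exists l.
  by exists m => //; exists 1; [apply: subgroup1 sL | rewrite mulg1].
- by move=> l Ll; exists 1; [apply: mM.1 | exists l => //; rewrite mul1g].
Qed.

(** * Submonoids generated by finitely many elements *)

Import Order.TTheory GRing.Theory Num.Theory.

(** * Additive groups and subgroups as groups in their own right *)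

Section AdditiveGroup.
Variable V : zmodType.

(** A copy of [V] whose group law is addition, so that direct products with a multiplicative group
    can be formed. *)
Definition additive_group : Type := V.
HB.instance Definition _ := gen_eqMixin additive_group.
HB.instance Definition _ := gen_choiceMixin additive_group.
HB.instance Definition _ := isGroup.Build additive_group
  (@addrA V) (@add0r V) (@addr0 V) (@addNr V) (@addrN V).

End AdditiveGroup.

Section Subgroup.
Variables (G : groupType) (S : set G) (sS : subgroup S).

Definition mem_subgroup : {pred G} := fun x => `[< S x >].

Fact mem_subgroup_closed : group_closed mem_subgroup.
Proof.
split; first by apply/asboolP; apply: subgroup1.
by move=> x y /asboolP Sx /asboolP Sy; apply/asboolP; apply: subgroupM (subgroupV _ _).
Qed.

Definition subgroup_type of subgroup S : Type := {x : G | mem_subgroup x}.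
HB.instance Definition _ := SubChoice.on (subgroup_type sS).
HB.instance Definition _ := SubChoice_isSubGroup.Build G mem_subgroup
  (subgroup_type sS) mem_subgroup_closed.

Definition subgroup_val (x : subgroup_type sS) : G := val x.

Lemma subgroup_valP x : S (subgroup_val x).
Proof. by apply/asboolP; exact: (valP x). Qed.

Lemma subgroup_val_onto x : S x -> exists y, subgroup_val y = x.
Proof. by move=> /asboolP Sx; exists (Sub x Sx : subgroup_type sS). Qed.

Lemma subgroup_val_inj : injective subgroup_val.
Proof. exact: val_inj. Qed.

Lemma subgroup_valM : {morph subgroup_val : x y / x * y}.
Proof. exact: valM. Qed.
Lemma subgroup_val1 : subgroup_val 1 = 1.
Proof. exact: val1. Qed.
Lemma subgroup_valV : {morph subgroup_val : x / x^-1}.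
Proof.
move=> x; rewrite -[LHS](mulKg (subgroup_val x)) -subgroup_valM mulgV.
by rewrite subgroup_val1 mulg1.
Qed.
End Subgroup.

Lemma subgroup_gen_image (G H : groupType) (f : G -> H) (A : set G) :
  {morph f : x y / x * y} -> f 1 = 1 -> {morph f : x / x^-1} ->
  subgroup_gen (f @` A) `<=` f @` subgroup_gen A.
Proof.
move=> fM f1 fV; have sA := subgroup_gen_subgroup A.
apply: subgroup_gen_min => [|_ [x Ax <-]]; last first.
  by exists x => //; apply: mem_subgroup_gen.
split; first split.
- by exists 1 => //; apply: (subgroup1 sA).
- by move=> _ _ [x Ax <-] [y Ay <-]; exists (x * y) => //; apply: (subgroupM sA).
- by move=> _ [x Ax <-]; exists x^-1 => //; apply: (subgroupV sA).
Qed.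

Lemma subgroup_gen_preimage (G H : groupType) (f : G -> H) (A : set G) (B : set H) :
  {morph f : x y / x * y} -> f 1 = 1 -> {morph f : x / x^-1} ->
  (forall x, A x -> B (f x)) ->
  forall x, subgroup_gen A x -> subgroup_gen B (f x).
Proof.
move=> fM f1 fV AB x Ax; have sB := subgroup_gen_subgroup B.
have := @subgroup_gen_min _ A [set x | subgroup_gen B (f x)]; apply => //.
  exact: subgroup_preim.
by move=> y Ay; apply: mem_subgroup_gen; apply: AB.
Qed.

(** * Relations and homomorphisms to the integers *)

Section Relations.
Variables (n : nat).

(** It is the graph of a homomorphism sending each [a i] to [v i] exactly when its only element
    above 1 is [(1, 0)]. *)
Definition graph_gen (G : groupType) (a : 'I_n -> G) (V : zmodType) (v : 'I_n -> V) :
    set (G * additive_group V) :=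
  subgroup_gen [set (a i, v i : additive_group V) | i in [set: 'I_n]].

Lemma graph_gen_subgroup (G : groupType) (a : 'I_n -> G) (V : zmodType) (v : 'I_n -> V) :
  subgroup (graph_gen a v).
Proof. exact: subgroup_gen_subgroup. Qed.

(** [e] is the vector of exponent sums of a word in the [a i] with value 1. These vectors form the
    lattice of relations in the abelianization of the generated group. *)
Definition relation (G : groupType) (a : 'I_n -> G) (e : 'rV[int]_n) :=
  graph_gen a (fun i => delta_mx 0%R i) (1, e).

Lemma relation0 (G : groupType) (a : 'I_n -> G) : relation a 0%R.
Proof. exact: (subgroup1 (graph_gen_subgroup _ _)). Qed.

Lemma relationB (G : groupType) (a : 'I_n -> G) e e' :
  relation a e -> relation a e' -> relation a (e - e')%R.
Proof.
have sR := graph_gen_subgroup a (fun i => delta_mx 0%R i : 'rV[int]_n).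
move=> Re Re'; have := subgroupM sR Re (subgroupV sR Re').
by rewrite /relation /= -[(_, _) * _]/(1 * 1^-1, (e - e')%R) mulgV.
Qed.

(** The linear form [ev] carries the graph of exponent sums onto the graph of [f], so [(1, z)] lifts
    to a relation, on which the form vanishes. *)
Lemma functional_graph (G : groupType) (a : 'I_n -> G) (f : 'I_n -> nat) :
  (forall e, relation a e -> \sum_i e 0 i * Posz (f i) = 0)%R ->
  forall z, graph_gen a (fun i => Posz (f i)) (1, z) -> z = 0%R.
Proof.
move=> relf z.
pose ev (e : 'rV[int]_n) := (\sum_i e 0 i * Posz (f i))%R.
have evD e e' : (ev (e + e') = ev e + ev e')%R.
  by rewrite /ev -big_split; apply: eq_bigr => i _; rewrite mxE mulrDl.
have evN e : (ev (- e) = - ev e)%R.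
  by rewrite /ev -sumrN; apply: eq_bigr => i _; rewrite mxE mulNr.
have ev0 : (ev 0 = 0)%R by apply: big1 => i _; rewrite mxE mul0r.
pose phi (p : G * additive_group 'rV[int]_n) : G * additive_group int := (p.1, ev p.2).
have phiM : {morph phi : p q / p * q} by move=> p q; congr pair; apply: evD.
have phi1 : phi 1 = 1 by congr pair; apply: ev0.
have phiV : {morph phi : p / p^-1} by move=> p; congr pair; apply: evN.
have := subgroup_gen_image (A := [set (a i, delta_mx 0%R i : additive_group 'rV[int]_n) | i in [set: 'I_n]]) phiM phi1 phiV.
rewrite (_ : phi @` _ = [set (a i, Posz (f i) : additive_group int) | i in [set: 'I_n]]).
  move=> sub /sub[[g e] Re [g1 <-]]; apply: relf.
  by rewrite /relation -g1.
have phiE i : phi (a i, delta_mx 0%R i) = (a i, Posz (f i)).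
  rewrite /phi; congr pair; rewrite /ev (bigD1 i) //= big1 ?addr0 ?mxE ?eqxx ?mul1r //.
  by move=> j /negPf ji; rewrite mxE eqxx ji mul0r.
apply/seteqP; split=> [_ [_ [i _ <-] <-]|_ [i _ <-]]; first by exists i; rewrite ?phiE.
by exists (a i, delta_mx 0%R i); [exists i|].
Qed.


Section PositiveRelation.
Variables (G : groupType) (a : 'I_n -> G) (e : 'rV[int]_n).
Hypothesis nilG : nilpotent_group G.
Hypothesis gen_a : subgroup_gen (range a) = [set: G].
Hypothesis rel_e : relation a e.
Hypothesis e_gt0 : forall i, (0 < e 0%R i)%R.

Let nN := lower_central_normal G 1.
Let pi := quotient_pi nN.

Let pi_comm x y : commute (pi x) (pi y).
Proof.
rewrite /commute -!quotient_piM; apply/esym/quotient_piE.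
by rewrite invgM -mulgA; exact: (@lower_centralR _ 0 x y).
Qed.

Let monomial (p : 'I_n -> nat) := \prod_i a i ^+ p i.

Let mod_monomial p := \prod_i pi (a i) ^+ p i.

Let pi_monomial p : pi (monomial p) = mod_monomial p.
Proof.
rewrite /monomial /mod_monomial (big_morph pi (quotient_piM nN) (quotient_pi1 nN)).
apply: eq_bigr => i _; elim: (p i) => [|k IHk]; first exact: quotient_pi1.
by rewrite !expgS /pi quotient_piM -/pi IHk.
Qed.

Let mod_monomialD p q :
  mod_monomial (fun i => p i + q i)%N = mod_monomial p * mod_monomial q.
Proof.
rewrite /mod_monomial; under eq_bigr do rewrite expgnDr.
by apply: prodgM_commute => i j _ _; exact: (commuteX2 _ _ (pi_comm _ _)).
Qed.

Let mod_monomial_delta j : mod_monomial (fun i => i == j) = pi (a j).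
Proof.
rewrite /mod_monomial; under eq_bigr do rewrite expgb.
by rewrite -big_mkcond big_pred1_eq.
Qed.

Let mod_comm x p : commute (pi x) (mod_monomial p).
Proof. by rewrite -pi_monomial; apply: pi_comm. Qed.

Let mod_relation : mod_monomial (fun i => `|e 0%R i|%N) = 1.
Proof.
(* Monomials have exponents in [nat], so an integer vector is written as a difference [p - q] and
   the equation as one without inverses. *)
pose R (ge : G * additive_group 'rV[int]_n) := exists p q : 'I_n -> nat,
  (forall i, (ge.2 : 'rV[int]_n) 0%R i = Posz (p i) - Posz (q i))%R /\
  pi ge.1 * mod_monomial q = mod_monomial p.
suff [p [q [epq /= pq]]] : R (1, e).
  apply: (@mulgI _ (mod_monomial q)); rewrite mulg1 -mod_monomialD.
  have -> : (fun i => q i + `|e 0%R i|)%N = p.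
    apply: funext => i; apply/eqP; rewrite -eqz_nat PoszD gtz0_abs //.
    by rewrite epq addrC subrK.
  by rewrite -pq [pi 1](quotient_pi1 nN) mul1g.
have: graph_gen a (fun i => delta_mx 0%R i : 'rV[int]_n) `<=` R; last exact.
apply: subgroup_gen_min.
  split; first split.
  - exists (fun=> 0), (fun=> 0); split=> [i|]; first by rewrite mxE.
    by rewrite [pi _](quotient_pi1 nN) mul1g.
  - move=> [g1 e1] [g2 e2] [p [q [/= epq pq]]] [p' [q' [/= epq' pq']]].
    exists (fun i => p i + p' i)%N, (fun i => q i + q' i)%N; split=> [i|].
      by rewrite /= mxE epq epq' !PoszD opprD addrACA.
    rewrite !mod_monomialD -pq -pq' /= [pi (_ * _)](quotient_piM nN) -!mulgA.
    by congr (_ * _); rewrite !mulgA (mod_comm g2 q).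
  - move=> [g1 e1] [p [q [/= epq pq]]]; exists q, p; split=> [i|].
      by rewrite /= mxE epq opprB.
    by rewrite /= [pi _](quotient_piV nN) -pq mulKg.
move=> _ [j _ <-]; exists (fun i => i == j), (fun=> 0); split=> [i|] /=.
  by rewrite mxE eqxx /= subr0; case: (i == j).
rewrite mod_monomial_delta [X in _ * X](_ : _ = 1) ?mulg1 //.
by rewrite /mod_monomial; apply: big1.
Qed.

Let inverse_mod_commutator i : exists2 m, monoid_gen (range a) m &
  exists2 l, lower_central 1 l & (a i)^-1 = m * l.
Proof.
(* One factor [a i] is removed from the relation; the subtraction does not truncate because [e] is
   positive at [i]. *)
pose p j := (`|e 0%R j| - (j == i))%N; exists (monomial p).
  have [M1 MM] := monoid_gen_submonoid (range a).
  apply: (big_ind (monoid_gen (range a))) => // j _.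
  apply: (submonoidX _ (monoid_gen_submonoid _)).
  by apply: mem_monoid_gen; exists j.
exists ((monomial p)^-1 * (a i)^-1); last by rewrite mulVKg.
apply/(quotient_piE nN); rewrite -/pi pi_monomial [RHS](quotient_piV nN).
apply: (@mulgI _ (pi (a i))); rewrite mulgV -mod_monomial_delta -mod_monomialD.
rewrite -[RHS]mod_relation; congr mod_monomial; apply: funext => j.
rewrite /p subnKC //; by case: eqP => // ->; rewrite absz_gt0 gt_eqF.
Qed.

Lemma positive_relation_invertible i : monoid_gen (range a) (a i)^-1.
Proof.
have [M1 MM] := monoid_gen_submonoid (range a).
have rangeE : range a = [set` codom a].
  by apply/seteqP; split=> [_ [j _ <-]|_ /= /codomP[j ->]]; [exact: codom_f | exists j].
apply: (@nilpotent_saturation G (codom a)) => //; first by rewrite -rangeE.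
have [T1 TM] := submonoid_mul_normal (monoid_gen_submonoid (range a)) nN.
set T := [set _ | _] in T1 TM.
(* [T] is only known to be a submonoid; its elements with inverse in [T] form a subgroup containing
   the generators. *)
suff: subgroup_gen (range a) `<=` [set g | T g /\ T g^-1].
  by rewrite gen_a => sub g; have [] := sub g I.
apply: subgroup_gen_min => [|_ [j _ <-]].
  split; first split.
  - by rewrite /= invg1.
  - by move=> x y [Tx TVx] [Ty TVy]; rewrite /= invgM; split; apply: TM.
  - by move=> x [Tx TVx]; rewrite /= invgK.
split; last exact: inverse_mod_commutator.
exists (a j); first by apply: mem_monoid_gen; exists j.
by exists 1; [apply: subgroup1 nN.1 | rewrite mulg1].
Qed.

End PositiveRelation.

End Relations.

Lemma subgroup_nilpotent (G : groupType) (S : set G) (sS : subgroup S) :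
  nilpotent_group G -> nilpotent_group (subgroup_type sS).
Proof.
move=> [n Gn]; exists n; apply/seteqP; split=> [x|_ ->]; last first.
  exact: subgroup1 (lower_central_subgroup _ _).
move=> Lx; apply: (@subgroup_val_inj _ _ sS); rewrite subgroup_val1.
suff: lower_central n (subgroup_val x) by rewrite Gn.
elim: n x Lx {Gn} => // n IHn.
apply: subgroup_gen_preimage; [exact: subgroup_valM|exact: subgroup_val1|
  exact: subgroup_valV|].
move=> _ [x Lx [y _ <-]]; exists (subgroup_val x); first exact: IHn.
by exists (subgroup_val y); rewrite // /commg /conjg !(subgroup_valM, subgroup_valV).
Qed.

Lemma generated_dichotomy (G : groupType) n (a : 'I_n -> G) :
  nilpotent_group G -> subgroup_gen (range a) = [set: G] ->
  (forall i, monoid_gen (range a) (a i)^-1) \/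
  exists2 f : 'I_n -> nat, (exists j, 0 < f j) &
    forall z, graph_gen a (fun i => Posz (f i)) (1, z) -> z = 0%R.
Proof.
move=> nilG gen_a; have R0 := @relation0 n G a; have RB := @relationB n G a.
case: (pselect (exists2 f : 'I_n -> nat, (exists j, 0 < f j) &
    forall z, graph_gen a (fun i => Posz (f i)) (1, z) -> z = 0%R)) => nof.
  by right.
left; have /choice[e eP] j : exists e, relation a e /\
    ((forall i, 0 <= e 0 i) /\ 0 < e 0 j)%R.
  case: (lattice_alternative R0 RB j) => [[e]|[f fj relf]]; first by exists e.
  by case: nof; exists f; [exists j | apply: functional_graph].
have RD u v : relation a u -> relation a v -> relation a (u + v)%R.
  by move=> Ru Rv; rewrite -[v]opprK; apply: (RB) => //; rewrite -sub0r; apply: (RB).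
(* Each [e j] is nonnegative and positive at [j], so the sum is positive everywhere. *)
apply: (@positive_relation_invertible _ _ a (\sum_j e j)%R) => //.
  by apply: (big_ind (relation a)) => // j _; have [] := eP j.
move=> i; rewrite summxE (bigD1 i) //=; have [_ [_ ei]] := eP i.
by rewrite ltr_pwDl // sumr_ge0 // => j _; have [_ []] := eP j.
Qed.

(** Both alternatives concern only the subgroup generated by [a], which is again nilpotent. *)
Lemma nilpotent_dichotomy (G : groupType) n (a : 'I_n -> G) :
  nilpotent_group G ->
  (forall i, monoid_gen (range a) (a i)^-1) \/
  exists2 f : 'I_n -> nat, (exists j, 0 < f j) &
    forall z, graph_gen a (fun i => Posz (f i)) (1, z) -> z = 0%R.
Proof.
move=> nilG; have sH := subgroup_gen_subgroup (range a).
have /choice[b bE] i : exists b, subgroup_val (b : subgroup_type sH) = a i.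
  by apply: subgroup_val_onto; apply: mem_subgroup_gen; exists i.
have aE : a = fun i => subgroup_val (b i) by apply: funext => i; rewrite bE.
have [||inv|[f f0 relf]] := @generated_dichotomy (subgroup_type sH) n b.
- exact: subgroup_nilpotent.
- apply/seteqP; split=> // h _.
  have sB := subgroup_gen_subgroup (range b).
  have: subgroup_gen (range a) `<=` @subgroup_val _ _ sH @` subgroup_gen (range b).
    rewrite {1}aE (_ : [set _ | _ in _] = @subgroup_val _ _ sH @` (range b)).
      by apply: subgroup_gen_image; [exact: subgroup_valM|exact: subgroup_val1|exact: subgroup_valV].
    by rewrite image_comp.
  by move=> /(_ _ (subgroup_valP h))[h' Bh' /subgroup_val_inj <-].
- left=> i; have [M1 MM] := monoid_gen_submonoid (range a).
  have: monoid_gen (range b) `<=` [set h | monoid_gen (range a) (subgroup_val h)].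
    apply: monoid_gen_min => [|_ [j _ <-]]; last first.
      by apply: mem_monoid_gen; exists j; rewrite ?bE.
    split; first by rewrite /= subgroup_val1.
    by move=> x y Mx My; rewrite /= subgroup_valM; apply: MM.
  by move=> /(_ _ (inv i)); rewrite /= subgroup_valV bE.
- right; exists f => // z.
  pose phi (p : subgroup_type sH * additive_group int) : G * additive_group int :=
    (subgroup_val p.1, p.2).
  rewrite /graph_gen aE (_ : [set _ | i in _] =
    phi @` [set (b i, Posz (f i) : additive_group int) | i in [set: 'I_n]]); last first.
    apply/seteqP; split=> [_ [i _ <-]|_ [_ [i _ <-] <-]]; last by exists i.
    by exists (b i, Posz (f i)); [exists i|].
  move=> /(subgroup_gen_image (f := phi))[| | |[h y] By [h1 <-]].
  + by move=> p q; congr pair; apply: subgroup_valM.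
  + by congr pair; apply: subgroup_val1.
  + by move=> p; congr pair; apply: subgroup_valV.
  apply: relf; rewrite (_ : 1 = h) //; apply: subgroup_val_inj.
  by rewrite h1 subgroup_val1.
Qed.

(** * Polycyclic sequences *)

Section Polycyclic.
Variable G : groupType.
Implicit Types (x y : G) (N D H : set G) (Y : seq G).

Definition list_gen Y := subgroup_gen [set` Y].

Lemma list_gen_subgroup Y : subgroup (list_gen Y).
Proof. exact: subgroup_gen_subgroup. Qed.

Lemma mem_list_gen Y y : y \in Y -> list_gen Y y.
Proof. by move=> yY; apply: mem_subgroup_gen. Qed.

Lemma list_gen_min Y H : subgroup H -> (forall y, y \in Y -> H y) -> list_gen Y `<=` H.
Proof. by move=> sH YH; apply: subgroup_gen_min. Qed.

Lemma list_gen_nil x : list_gen [::] x -> x = 1.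
Proof.
apply: (@list_gen_min _ [set 1]) => //; split; first split=> //.
  by move=> u v -> ->; rewrite /= mulg1.
by move=> u ->; rewrite /= invg1.
Qed.

Lemma list_gen_rcons Y y : list_gen Y `<=` list_gen (rcons Y y).
Proof.
apply: list_gen_min; first exact: list_gen_subgroup.
by move=> z zY; apply: mem_list_gen; rewrite mem_rcons inE zY orbT.
Qed.

(** Both signs are required: conjugation by [y] may map an infinite [N] properly into itself. *)
Definition normalizes y N := forall x, N x -> N (x ^ y) /\ N (x ^ y^-1).

Lemma normalizer_subgroup N : subgroup [set y | normalizes y N].
Proof.
split; first split.
- by move=> x Nx; rewrite invg1 conjg1.
- move=> y z ny nz x Nx; rewrite invgM !conjgM.
  by split; [apply: (nz _ _).1; apply: (ny _ _).1 | apply: (ny _ _).2; apply: (nz _ _).2].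
- by move=> y ny x Nx; rewrite invgK; have [] := ny x Nx.
Qed.

Lemma subgroup_normalizes N y : subgroup N -> N y -> normalizes y N.
Proof.
by move=> sN Ny x Nx; split; apply: subgroupJ => //; apply: subgroupV.
Qed.

Section Coset.
Variables (N : set G) (y : G).
Hypothesis sN : subgroup N.
Hypothesis ny : normalizes y N.

Definition in_coset_pow j x := N (y ^- j * x).
Local Notation C := in_coset_pow.

Lemma normalizesX j : normalizes (y ^+ j) N.
Proof. exact: (subgroupX j (normalizer_subgroup N)). Qed.

Lemma coset_powE j x : C j x -> exists2 n, N n & x = y ^+ j * n.
Proof. by exists (y ^- j * x) => //; rewrite mulVKg. Qed.

Lemma coset_pow0 x : C 0 x <-> N x.
Proof. by rewrite /in_coset_pow invg1 mul1g. Qed.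

Lemma coset_powM j k x x' : C j x -> C k x' -> C (j + k) (x * x').
Proof.
move=> /coset_powE[n Nn ->] /coset_powE[m Nm ->]; rewrite /in_coset_pow.
have -> : y ^- (j + k) * (y ^+ j * n * (y ^+ k * m)) = n ^ (y ^+ k) * m.
  by rewrite expgnDr invgM conjgE -!mulgA mulKg.
by apply: (subgroupM sN) => //; apply: (normalizesX k Nn).1.
Qed.

Lemma coset_powX j k x : C j x -> C (j * k) (x ^+ k).
Proof.
move=> Cx; elim: k => [|k IHk]; last by rewrite expgS mulnS; apply: coset_powM.
by rewrite muln0; apply/coset_pow0; apply: (subgroup1 sN).
Qed.

Lemma coset_powF j k x x' : k <= j -> C j x -> C k x' -> C (j - k) (x / x').
Proof.
move=> kj /coset_powE[n Nn ->] /coset_powE[m Nm ->]; rewrite /in_coset_pow.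
have -> : y ^- (j - k) * (y ^+ j * n / (y ^+ k * m)) = (n / m) ^ (y ^+ k)^-1.
  rewrite -{2}(subnK kj) expgnDr conjgE invgK invgM -!mulgA mulKg.
  by [].
by apply: (normalizesX k _).2; apply: (subgroupM sN) => //; apply: (subgroupV sN).
Qed.

Lemma coset_powVF j k x x' : k <= j -> C j x -> C k x' -> C (j - k) (x'^-1 * x).
Proof.
move=> kj /coset_powE[n Nn ->] /coset_powE[m Nm ->]; rewrite /in_coset_pow.
have -> : y ^- (j - k) * ((y ^+ k * m)^-1 * (y ^+ j * n)) =
    m^-1 ^ (y ^+ (j - k)) * n.
  by rewrite -{2}(subnKC kj) expgnDr conjgE invgM -!mulgA mulKg.
apply: (subgroupM sN) => //; apply: (normalizesX (j - k) _).1.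
exact: (subgroupV sN).
Qed.

Lemma coset_pow_leV j k x x' : C j x -> C k x' ->
  exists i, C i (x / x') \/ C i (x / x')^-1.
Proof.
have [kj|/ltnW jk] := leqP k j => Cx Cx'; first by exists (j - k); left; apply: coset_powF.
by exists (k - j); right; rewrite invgF; apply: coset_powF.
Qed.

(** The subgroup generated by [N] and [y] when [y] normalizes [N]; exponents are natural, and [x^-1]
    accounts for negative powers. *)
Definition coset_pow_any : set G := [set x | exists j, C j x \/ C j x^-1].

Lemma coset_pow_any_subgroup : subgroup coset_pow_any.
Proof.
split; first split.
- by exists 0; left; apply/coset_pow0; apply: (subgroup1 sN).
- move=> x x' [j [Cx|Cx]] [k [Cx'|Cx']].
  + by exists (j + k); left; apply: coset_powM.
  + by rewrite -[x']invgK; apply: coset_pow_leV Cx Cx'.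
  + have [kj|/ltnW jk] := leqP k j.
      by exists (j - k); right; rewrite invgM; apply: coset_powVF.
    by exists (k - j); left; rewrite -{1}[x]invgK; apply: coset_powVF.
  + by exists (k + j); right; rewrite invgM; apply: coset_powM.
- by move=> x [j [Cx|Cx]]; exists j; [right; rewrite invgK | left].
Qed.

(** The image of [H] modulo [N] is cyclic. By Euclidean division it is generated by an element [t]
    of least positive exponent, or is trivial with [t = 1]. *)
Lemma coset_pow_gen H : H `<=` coset_pow_any -> subgroup H ->
  exists2 t, H t & forall h, H h -> exists q, N (h * t ^- q) \/ N (h^-1 * t ^- q).
Proof.
move=> HC sH; pose J j := `[< 0 < j /\ exists2 h, H h & C j h >].
case: (pselect (exists j, J j)) => [exJ|noJ]; last first.
  exists 1; first exact: (subgroup1 sH).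
  move=> h Hh; exists 0; rewrite !expg0 !invg1 !mulg1.
  have C0 g j : H g -> C j g -> N g.
    case: j => [_ /coset_pow0 //|j Hg Cg]; case: noJ; exists j.+1.
    by apply/asboolP; split=> //; exists g.
  have [j [Ch|Ch]] := HC h Hh; [left | right]; apply: (C0 _ j) => //.
  exact: (subgroupV sH).
case: (ex_minnP exJ) => d /asboolP[d0 [t Ht Ct]] mind; exists t => // h Hh.
have red g j : H g -> C j g -> N (g * t ^- (j %/ d)).
  move=> Hg Cg; have := coset_powF (leq_divM j d) Cg.
  move=> /(_ (t ^+ (j %/ d))); rewrite mulnC => /(_ (coset_powX _ Ct)).
  have -> : (j - d * (j %/ d) = j %% d)%N by rewrite {1}(divn_eq j d) mulnC addKn.
  have: j %% d < d by rewrite ltn_mod.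
  case E: (j %% d) => [|k] lt_d; first by move/coset_pow0.
  move=> Ck; have := mind k.+1; rewrite leqNgt lt_d => /(_ _)/negP[] //.
  apply/asboolP; split=> //; exists (g * t ^- (j %/ d)) => //.
  by apply: (subgroupM sH) => //; apply: (subgroupV sH); apply: (subgroupX _ sH).
have [j [Ch|Ch]] := HC h Hh; exists (j %/ d); [left | right]; apply: red => //.
exact: (subgroupV sH).
Qed.

End Coset.

Lemma list_gen_rcons_coset Y y : normalizes y (list_gen Y) ->
  list_gen (rcons Y y) `<=` coset_pow_any (list_gen Y) y.
Proof.
have sN := list_gen_subgroup Y.
move=> ny; apply: (@list_gen_min _ (coset_pow_any _ _)); first exact: (coset_pow_any_subgroup sN ny).
move=> z; rewrite mem_rcons inE => /orP[/eqP->|zY].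
  by exists 1%N; left; rewrite /in_coset_pow mulVg; apply: (subgroup1 sN).
by exists 0; left; apply/coset_pow0; apply: mem_list_gen.
Qed.

Lemma list_gen_rcons_normalizes Y y x : normalizes y (list_gen Y) ->
  list_gen (rcons Y y) x -> normalizes x (list_gen Y).
Proof.
move=> ny; apply: (@list_gen_min _ [set y | normalizes y (list_gen Y)]).
  exact: normalizer_subgroup.
move=> z; rewrite mem_rcons inE => /orP[/eqP->//|zY].
by apply: subgroup_normalizes; [apply: list_gen_subgroup | apply: mem_list_gen].
Qed.

(** The sequence is read from the bottom: each prefix generates a normal subgroup of the next one,
    with cyclic quotient, finite or infinite. *)
Inductive polycyclic : seq G -> Prop :=
| Polycyclic_nil : polycyclic [::]
| Polycyclic_rcons Y y : polycyclic Y -> normalizes y (list_gen Y) ->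
    polycyclic (rcons Y y).

Lemma subgroupI H H' : subgroup H -> subgroup H' -> subgroup (H `&` H').
Proof.
move=> sH sH'; split; first split.
- by split; [apply: (subgroup1 sH) | apply: (subgroup1 sH')].
- by move=> x y [? ?] [? ?]; split; [apply: (subgroupM sH) | apply: (subgroupM sH')].
- by move=> x [? ?]; split; [apply: (subgroupV sH) | apply: (subgroupV sH')].
Qed.

Lemma coset_pow_gen_normalizes N H t : subgroup N -> normalizes t N ->
  (forall h, H h -> exists q, N (h * t ^- q) \/ N (h^-1 * t ^- q)) ->
  forall h, H h -> exists q, N (h * t ^- q) \/ N (h * t ^+ q).
Proof.
move=> sN nt Ht h /Ht[q [Nh|Nh]]; exists q; [by left | right].
have := (normalizesX nt q (subgroupV sN Nh)).1.
by rewrite invgM !invgK conjgE -mulgA mulKg.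
Qed.

(** By induction, [H] is generated by generators of its intersection with [list_gen Y] and one
    element generating it modulo that intersection. This is what guarantees that finite certificates
    exist. *)
Lemma polycyclic_noetherian Y H : polycyclic Y -> subgroup H -> H `<=` list_gen Y ->
  exists S : seq G, H = list_gen S.
Proof.
move=> pY; elim: pY H => {Y} [|Y y pY IHY ny] H sH HY.
  exists [::]; apply/seteqP; split=> [x /HY //|x /list_gen_nil ->].
  exact: (subgroup1 sH).
have sN := list_gen_subgroup Y.
have [|S HS] := IHY _ (subgroupI sH sN); first by move=> x [].
have [|t Ht tH] := coset_pow_gen sN ny _ sH.
  by move=> x /HY; apply: list_gen_rcons_coset.
have sS := list_gen_subgroup (t :: S); exists (t :: S); apply/seteqP; split=> [h Hh|].
  have SD x : H x -> list_gen Y x -> list_gen (t :: S) x.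
    move=> Hx Nx; have: (H `&` list_gen Y) x by [].
    rewrite HS; apply: list_gen_min => // z zS.
    by apply: mem_list_gen; rewrite inE zS orbT.
  have St : list_gen (t :: S) t by apply: mem_list_gen; rewrite inE eqxx.
  have HtV q : H (t ^- q) by apply: (subgroupV sH); apply: (subgroupX _ sH).
  have [q [Nh|Nh]] := tH h Hh.
    rewrite -(mulgVK (t ^+ q) h); apply: (subgroupM sS); last exact: (subgroupX _ sS).
    by apply: SD => //; apply: (subgroupM sH).
  rewrite -[h]invgK; apply: (subgroupV sS); rewrite -(mulgVK (t ^+ q) h^-1).
  apply: (subgroupM sS); last exact: (subgroupX _ sS).
  by apply: SD => //; apply: (subgroupM sH) => //; apply: (subgroupV sH).
apply: list_gen_min => // z; rewrite inE => /orP[/eqP-> //|zS].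
by have := mem_list_gen zS; rewrite -HS => -[].
Qed.

(** The sequence climbs the lower central series: generators of a term modulo the next are appended
    one by one, and every intermediate subgroup is normal because it lies between consecutive
    terms. *)
Lemma nilpotent_polycyclic (X : seq G) : nilpotent_group G ->
  list_gen X = [set: G] -> exists2 Y, polycyclic Y & list_gen Y = [set: G].
Proof.
move=> [n Ln] genX.
suff H i : i <= n -> exists2 Y, polycyclic Y & list_gen Y = lower_central (n - i).
  by have := H n (leqnn n); rewrite subnn.
elim: i => [|i IHi] lt_i.
  exists [::]; first exact: Polycyclic_nil.
  rewrite subn0 Ln; apply/seteqP; split=> [x /list_gen_nil //|x ->].
  exact: (subgroup1 (list_gen_subgroup _)).
have [Y pY genY] := IHi (ltnW lt_i); set m := (n - i.+1)%N.
have mE : (n - i = m.+1)%N by rewrite /m subnS prednK // subn_gt0.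
rewrite mE in genY; have sL := lower_central_subgroup G m.
have [S SL genS] := lower_central_fg m genX.
have YL : list_gen Y `<=` lower_central m by rewrite genY; apply: lower_centralS.
suff [pYS YSL] : polycyclic (Y ++ S) /\ list_gen (Y ++ S) `<=` lower_central m.
  exists (Y ++ S) => //; apply/seteqP; split=> //.
  have sYS := list_gen_subgroup (Y ++ S).
  apply: genS => //; first by move=> s sS; apply: mem_list_gen; rewrite mem_cat sS orbT.
  rewrite -genY; apply: list_gen_min => // y yY.
  by apply: mem_list_gen; rewrite mem_cat yY.
elim/last_ind: S SL {genS} => [|S s IHS] SL; first by rewrite cats0.
have [|pYS YSL] := IHS; first by move=> z zS; apply: SL; rewrite /= mem_rcons inE zS orbT.
have Ls : lower_central m s by apply: SL; rewrite /= mem_rcons inE eqxx.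
rewrite -rcons_cat; split.
  apply: Polycyclic_rcons => //; have sYS := list_gen_subgroup (Y ++ S).
  have [|_ nYS] := lower_central_between sYS _ YSL; last by move=> x Sx; split; apply: nYS.
  rewrite -genY; apply: list_gen_min => // y yY.
  by apply: mem_list_gen; rewrite mem_cat yY.
apply: list_gen_min => // z; rewrite mem_rcons inE => /orP[/eqP-> //|zYS].
by apply: YSL; apply: mem_list_gen.
Qed.

End Polycyclic.

(** * The word problem *)

Section Words.
Variable G : groupType.
Implicit Types (x y : G) (Y : seq G) (u v w : seq nat) (T : seq (seq nat)).

(** The numbering agrees with [encode_letter]. Letters beyond [Y] have value 1, so every sequence of
    numbers is a word. *)
Definition letter_eval Y (l : nat) : G :=
  let y := nth 1 Y l./2 in if odd l then y^-1 else y.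

Definition word_eval Y w : G := \prod_(l <- w) letter_eval Y l.

Lemma word_eval_nil Y : word_eval Y [::] = 1.
Proof. exact: big_nil. Qed.

Lemma word_eval_cat Y u v : word_eval Y (u ++ v) = word_eval Y u * word_eval Y v.
Proof. exact: big_cat. Qed.

Lemma word_eval_seq1 Y l : word_eval Y [:: l] = letter_eval Y l.
Proof. exact: big_seq1. Qed.

Lemma letter_eval_double Y i : letter_eval Y i.*2 = nth 1 Y i.
Proof. by rewrite /letter_eval odd_double doubleK. Qed.

Lemma letter_eval_doubleS Y i : letter_eval Y i.*2.+1 = (nth 1 Y i)^-1.
Proof. by rewrite /letter_eval /= odd_double uphalf_double. Qed.

Lemma letter_eval_out Y l : size Y <= l./2 -> letter_eval Y l = 1.
Proof. by move=> le_l; rewrite /letter_eval nth_default // invg1 if_same. Qed.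

Lemma letter_eval_gen Y l : list_gen Y (letter_eval Y l).
Proof.
have sY := list_gen_subgroup Y.
have [lt_l|/letter_eval_out->] := ltnP l./2 (size Y); last exact: (subgroup1 sY).
have Yl : list_gen Y (nth 1 Y l./2) by apply: mem_list_gen; apply: mem_nth.
by rewrite /letter_eval; case: odd => //; apply: (subgroupV sY).
Qed.

Lemma letter_eval_flip Y l : exists l', letter_eval Y l' = (letter_eval Y l)^-1.
Proof.
case E: (odd l); [exists (l./2).*2 | exists (l./2).*2.+1].
  by rewrite letter_eval_double /letter_eval E invgK.
by rewrite letter_eval_doubleS /letter_eval E.
Qed.

Lemma word_eval_inv Y w : exists v, word_eval Y v = (word_eval Y w)^-1.
Proof.
elim: w => [|l w [v vE]]; first by exists [::]; rewrite word_eval_nil invg1.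
have [l' lE] := letter_eval_flip Y l; exists (v ++ [:: l']).
by rewrite word_eval_cat word_eval_seq1 vE lE -invgM -word_eval_seq1 -word_eval_cat.
Qed.

Lemma list_genP Y x : list_gen Y x <-> exists w, word_eval Y w = x.
Proof.
split=> [|[w <-]].
  apply: (@list_gen_min _ _ [set x | exists w, word_eval Y w = x]).
    split; first split.
    - by exists [::]; rewrite word_eval_nil.
    - by move=> _ _ [u <-] [v <-]; exists (u ++ v); rewrite word_eval_cat.
    - by move=> _ [u <-]; have [v vE] := word_eval_inv Y u; exists v.
  move=> y yY; exists [:: (index y Y).*2].
  by rewrite word_eval_seq1 letter_eval_double nth_index.
have sY := list_gen_subgroup Y.
apply: (big_ind (list_gen Y)) => [|a b|l _].
- exact: (subgroup1 sY).
- exact: (subgroupM sY).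
- exact: letter_eval_gen.
Qed.

Lemma word_eval_subst Y T w :
  word_eval Y (subst T w) = \prod_(l <- w) word_eval Y (nth [::] T l).
Proof.
by elim: w => [|l w IHw]; rewrite ?big_nil ?word_eval_nil // big_cons -IHw -word_eval_cat.
Qed.

Lemma substitution_table Y (phi : G -> G) : phi 1 = 1 ->
  (forall x, list_gen Y x -> list_gen Y (phi x)) ->
  exists T, forall l, word_eval Y (nth [::] T l) = phi (letter_eval Y l).
Proof.
move=> phi1 phiY.
have /choice[t tE] l : exists w, word_eval Y w = phi (letter_eval Y l).
  by apply/list_genP; apply: phiY; apply: letter_eval_gen.
exists (mkseq t (size Y).*2) => l; have [lt_l|le_l] := ltnP l (size Y).*2.
  by rewrite nth_mkseq.
rewrite nth_default ?size_mkseq // word_eval_nil letter_eval_out ?phi1 //.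
by have := half_leq le_l; rewrite doubleK.
Qed.

Lemma conj_substitution Y y : normalizes y (list_gen Y) ->
  exists T, forall w, word_eval Y (subst T w) = word_eval Y w ^ y.
Proof.
move=> ny; have [T TE] := @substitution_table Y (fun x => x ^ y) (conj1g y) (fun x Yx => (ny x Yx).1).
exists T => w; rewrite word_eval_subst /word_eval conjg_prod.
by apply: eq_bigr => l _; rewrite -TE.
Qed.

Definition word_pow w n := iter n (cat w) [::].

Lemma word_eval_pow Y w n : word_eval Y (word_pow w n) = word_eval Y w ^+ n.
Proof.
elim: n => [|n IHn]; first exact: word_eval_nil.
by rewrite [word_pow _ _]/(w ++ word_pow w n) word_eval_cat IHn expgS.
Qed.

Lemma letter_eval_rcons Y y l :
  letter_eval (rcons Y y) l =
    if l == (size Y).*2 then y else if l == (size Y).*2.+1 then y^-1 else letter_eval Y l.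
Proof.
have [->|l0] := eqVneq l (size Y).*2.
  by rewrite letter_eval_double nth_rcons ltnn eqxx.
have [->|l1] := eqVneq l (size Y).*2.+1.
  by rewrite letter_eval_doubleS nth_rcons ltnn eqxx.
rewrite /letter_eval nth_rcons; case: ltnP => // le_l.
case: eqP => [e|_]; last by rewrite nth_default.
by move: l0 l1; rewrite -{1 2}(odd_double_half l) e; case: odd; rewrite ?eqxx // add1n eqxx.
Qed.

(* The word [w] over [rcons Y y] is rewritten as [y ^+ a * y ^- b * u], with
   [u] a word over [Y]; [Tp] and [Tn] are the substitutions that conjugate by
   [y] and [y^-1]. *)
Definition collect m Tp Tn w : nat * (nat * seq nat) :=
  foldl (fun s l => if l == m.*2 then (s.1.+1, (s.2.1, subst Tp s.2.2))
    else if l == m.*2.+1 then (s.1, (s.2.1.+1, subst Tn s.2.2))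
    else (s.1, (s.2.1, rcons s.2.2 l))) (0, (0, [::])) w.

Lemma collectE Y y Tp Tn w :
  (forall w, word_eval Y (subst Tp w) = word_eval Y w ^ y) ->
  (forall w, word_eval Y (subst Tn w) = word_eval Y w ^ y^-1) ->
  let s := collect (size Y) Tp Tn w in
  word_eval (rcons Y y) w = y ^+ s.1 * y ^- s.2.1 * word_eval Y s.2.2.
Proof.
move=> TpE TnE /=; elim/last_ind: w => [|w l IHw].
  by rewrite !word_eval_nil expg0 invg1 !mulg1.
rewrite -(cats1 w) word_eval_cat word_eval_seq1 letter_eval_rcons {}IHw.
rewrite /collect cats1 foldl_rcons -/(collect _ _ _ _).
case: (collect _ _ _ _) => [a [b u]] /=.
have cyb : commute (y ^+ a) (y ^- b) by apply: commuteV; apply: commuteX2.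
have cy n : commute y (y ^+ n) by apply: commuteX.
case: eqP => _ /=; last case: eqP => _ /=.
- rewrite TpE conjgE expgSr -!mulgA; congr (_ * _).
  by rewrite !mulgA (commuteV (cy b)) mulgK.
- rewrite TnE conjgE invgK expgSr invgM -!mulgA; congr (_ * _).
  by rewrite !mulgA -(mulgA y^-1) -(commuteV (cy b)) mulKg.
- by rewrite -cats1 word_eval_cat word_eval_seq1 mulgA.
Qed.

Lemma recursive_collect m Tp Tn : recursive (collect m Tp Tn).
Proof.
apply: (@recursive_foldl (seq_codeType nat_codeType) nat_codeType
    (prod_codeType nat_codeType (prod_codeType nat_codeType (seq_codeType nat_codeType)))
    (fun=> (0, (0, [::]))) (fun w => w) (fun p => if p.2.2 == m.*2
    then (p.2.1.1.+1, (p.2.1.2.1, subst Tp p.2.1.2.2))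
    else if p.2.2 == m.*2.+1 then (p.2.1.1, (p.2.1.2.1.+1, subst Tn p.2.1.2.2))
    else (p.2.1.1, (p.2.1.2.1, rcons p.2.1.2.2 p.2.2)))); rec.
apply: recursive_if_eq; rec.
- by apply: recursive_succ; rec.
- by apply: recursive_subst; rec.
apply: recursive_if_eq; rec.
- by apply: recursive_succ; rec.
- by apply: recursive_subst; rec.
apply: (@recursive_ext _ _ (fun p => p.2.1.2.2 ++ [:: p.2.2])) => [p|]; first by rewrite cats1.
by apply: recursive_cat; rec; apply: recursive_cons; rec.
Qed.

Lemma recursive_word_pow (X : codeType) (w : X -> seq nat) (n : X -> nat) :
  recursive w -> recursive n -> recursive (fun t => word_pow (w t) (n t)).
Proof.
move=> Cw Cn; apply: (recursive_ext _ (recursive_natrec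
  (g := fun p => w p.1 ++ p.2.2) Cn (recursive_const _ [::]) _)) => [t|].
  by elim: (n t) => //= k ->.
by apply: recursive_cat; rec; apply: (recursive_comp Cw); rec.
Qed.

(** Collecting gives [y ^+ a * y ^- b * u] with [u] over [Y]. If this is 1, the power of [y] lies in
    [N], hence is a power of the fixed word [s] for [y ^+ r]; replacing it leaves a word over the
    shorter sequence. *)
Lemma polycyclic_word_problem Y : polycyclic Y ->
  r_e (fun w => word_eval Y w = 1).
Proof.
elim=> {Y} [|Y y pY IHY ny].
  apply: (r_e_ext _ (r_e_const _ True)) => w; split=> // _.
  by rewrite /word_eval big1 // => l _; rewrite letter_eval_out.
have sN := list_gen_subgroup Y; set N := list_gen Y in ny sN.
have [Tp TpE] := conj_substitution ny.
have nyV : normalizes y^-1 N by apply: (subgroupV (normalizer_subgroup N)).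
have [Tn TnE] := conj_substitution nyV.
(* [r] is the order of [y] modulo [N], with [r = 0] if the order is infinite. *)
have [r [Nr minr]] : exists r, N (y ^+ r) /\ forall j, N (y ^+ j) -> exists k, j = (r * k)%N.
  case: (pselect (exists r, `[< 0 < r /\ N (y ^+ r) >])) => [exr|nor].
    case: (ex_minnP exr) => r /asboolP[r0 Nr] minr; exists r; split=> // j Nj.
    exists (j %/ r)%N; rewrite mulnC {1}(divn_eq j r).
    suff /eqP -> : j %% r == 0%N by rewrite addn0.
    rewrite -leqn0 leqNgt; apply/negP => jr0; have := minr (j %% r)%N.
    suff Pj : `[< 0 < j %% r /\ N (y ^+ (j %% r)) >].
      by move=> /(_ Pj); rewrite leqNgt ltn_pmod.
    apply/asboolP; split=> //.
    have -> : y ^+ (j %% r) = (y ^+ r ^+ (j %/ r))^-1 * y ^+ j.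
      by rewrite -expgnA {3}(divn_eq j r) expgnDr mulnC mulKg.
    by apply: (subgroupM sN) => //; apply: (subgroupV sN); apply: (subgroupX _ sN).
  exists 0%N; split=> [|j Nj]; first exact: (subgroup1 sN).
  exists 0%N; apply/eqP; rewrite -leqn0 leqNgt; apply/negP => j0.
  by case: nor; exists j; apply/asboolP.
have [s sE] := (list_genP Y _).1 Nr.
have [s' s'E] := (list_genP Y _).1 (subgroupV sN Nr).
pose C := collect (size Y) Tp Tn.
have CC : recursive C := recursive_collect _ _ _.
(* The equation says [a - b = r * (q - p)] without subtraction; [s'] spells the inverse of [s]. *)
pose R (p : seq nat * nat * nat) := (C p.1.1).1 + r * p.1.2 = (C p.1.1).2.1 + r * p.2 /\
  word_eval Y (word_pow s p.2 ++ (word_pow s' p.1.2 ++ (C p.1.1).2.2)) = 1.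
have R_re : r_e R.
  have CCp : recursive (fun p : seq nat * nat * nat => C p.1.1).
    by apply: (recursive_comp CC); rec.
  apply: r_e_and.
    by apply: r_e_eq; apply: recursive_add; rec; apply: recursive_mul; rec.
  apply: (r_e_preimage IHY).
  by do !(apply: recursive_cat; rec); apply: recursive_word_pow; rec.
apply: (r_e_ext _ (r_e_exists (r_e_exists R_re))) => w; rewrite /R /=.
rewrite (collectE _ TpE TnE) -/(C w); case: (C w) => [a [b u]] /=.
have rel p q : a + r * p = b + r * q -> y ^+ a * y ^- b = y ^+ (r * q) * y ^- (r * p).
  move=> e; apply: (mulIg (y ^+ (r * p))); rewrite mulgVK -mulgA.
  rewrite -[y ^- b * _](commuteV (commuteX2 (r * p) b (commute_refl y))).
  by rewrite mulgA -expgnDr e addnC expgnDr mulgK.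
have powE p q : word_eval Y (word_pow s q ++ (word_pow s' p ++ u)) =
    y ^+ (r * q) * y ^- (r * p) * word_eval Y u.
  by rewrite !word_eval_cat !word_eval_pow sE s'E expVgn -!expgnA !mulgA.
split=> [[p [q [/rel -> <-]]]|w1]; first by rewrite powE.
have Nab : N (y ^+ a * y ^- b).
  rewrite -(mulgK (word_eval Y u) (y ^+ a * _)) w1 mul1g.
  by apply: (subgroupV sN); apply/list_genP; exists u.
have [ba|ab] := leqP b a.
  have [k kE] : exists k, (a - b = r * k)%N by apply: minr; rewrite expgnFr.
  have e : a + r * 0 = b + r * k by rewrite muln0 addn0 -kE subnKC.
  by exists 0%N, k; split=> //; rewrite powE -rel.
have [k kE] : exists k, (b - a = r * k)%N.
  apply: minr; rewrite expgnFr ?(ltnW ab) // -[_ * _]invgK invgF.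
  by apply: (subgroupV sN).
have e : a + r * k = b + r * 0 by rewrite muln0 addn0 -kE subnKC // ltnW.
by exists k, 0%N; split=> //; rewrite powE -rel.
Qed.

End Words.

(** * Certificates for trivial intersections *)

Lemma r_e_all_in (X : codeType) (R : X * seq nat -> Prop) (s : X -> seq (seq nat)) :
  r_e R -> recursive s -> r_e (fun x => forall w, w \in s x -> R (x, w)).
Proof.
move=> CR Cs; apply: (r_e_ext _ (r_e_all [::] CR Cs)) => x; split=> [H w|H i lt_i].
  by move=> /(nthP [::])[i lt_i <-]; apply: H.
by apply: H; apply: mem_nth.
Qed.

Section Certificates.
Variables (G : groupType) (ev : seq nat -> G).
Hypothesis ev_nil : ev [::] = 1.
Hypothesis ev_cat : forall u v, ev (u ++ v) = ev u * ev v.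
Hypothesis ev_surj : forall x, exists w, ev w = x.
Hypothesis ev_re : r_e (fun w => ev w = 1).
Implicit Types (C B : seq (seq nat)) (u v w t : seq nat) (x y : G).

Let ev_subst_cat C u v : ev (subst C (u ++ v)) = ev (subst C u) * ev (subst C v).
Proof. by rewrite /subst map_cat flatten_cat ev_cat. Qed.

Let ev_subst1 C i : ev (subst C [:: i]) = ev (nth [::] C i).
Proof. by rewrite /subst /= cats0. Qed.

Let words_gen C := list_gen (map ev C).

Let words_gen_subgroup C : subgroup (words_gen C).
Proof. exact: list_gen_subgroup. Qed.

Let words_gen_subst C u : words_gen C (ev (subst C u)).
Proof.
elim: u => [|i u IHu]; first by rewrite ev_nil; apply: (subgroup1 (words_gen_subgroup C)).
rewrite -cat1s ev_subst_cat ev_subst1; apply: (subgroupM (words_gen_subgroup C)) => //.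
have [lt_i|le_i] := ltnP i (size C); first by apply: mem_list_gen; apply: map_f; apply: mem_nth.
by rewrite nth_default // ev_nil; apply: (subgroup1 (words_gen_subgroup C)).
Qed.

(** The inverse of [ev w] is a product of entries of [C]. For inverse-closed [C] this is membership
    in the generated subgroup, in a form that is directly enumerable; closure itself also expresses
    that all entries are invertible in their monoid. *)
Definition inverse_in C w := exists u, ev (w ++ subst C u) = 1.
Definition inverse_closed C := forall c, c \in C -> inverse_in C c.

Lemma inverse_inP C w : inverse_closed C -> inverse_in C w <-> words_gen C (ev w).
Proof.
move=> Cinv; split=> [[u]|].
  rewrite ev_cat => /mulg1_eq e; rewrite -[ev w]invgK e.
  by apply: (subgroupV (words_gen_subgroup C)).
pose T : set G := [set x | (exists u, x = ev (subst C u)) /\ exists u, x * ev (subst C u) = 1].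
suff: words_gen C `<=` T by move=> sub /sub[_ [u e]]; exists u; rewrite ev_cat.
apply: list_gen_min => [|x /mapP[c cC ->]]; last first.
  split; last by have [u e] := Cinv c cC; exists u; rewrite -ev_cat.
  by exists [:: index c C]; rewrite ev_subst1 nth_index.
split; first split.
- by split; exists [::]; rewrite ev_nil ?mulg1.
- move=> x y [[u ->] [v xv]] [[u' ->] [v' yv]]; split; first by exists (u ++ u'); rewrite ev_subst_cat.
  by exists (v' ++ v); rewrite ev_subst_cat -mulgA (mulgA (ev (subst C u'))) yv mul1g.
- move=> x [[u xu] [v /mulg1_eq xv]]; split; first by exists v.
  by exists u; rewrite -xu mulVg.
Qed.

Lemma inverse_closed_words (S : seq G) :
  exists C, inverse_closed C /\ words_gen C = list_gen S.
Proof.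
have /choice[f fE] x := ev_surj x.
pose C := map f S ++ map (fun x => f x^-1) S; exists C; split.
  move=> c; rewrite mem_cat => /orP[] /mapP[x xS ->].
    exists [:: index (f x^-1) C]; rewrite ev_cat ev_subst1 nth_index ?fE ?mulgV //.
    by rewrite mem_cat (map_f (fun x => f x^-1)) ?orbT.
  exists [:: index (f x) C]; rewrite ev_cat ev_subst1 nth_index ?fE ?mulVg //.
  by rewrite mem_cat map_f.
have sS := list_gen_subgroup S.
apply/seteqP; split; apply: list_gen_min => //.
  move=> _ /mapP[c cC ->]; move: cC; rewrite mem_cat => /orP[]/mapP[x xS ->]; rewrite fE.
    exact: mem_list_gen.
  by apply: (subgroupV sS); apply: mem_list_gen.
by move=> x xS; rewrite -(fE x); apply: mem_list_gen; apply: map_f; rewrite mem_cat map_f.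
Qed.

Lemma r_e_inverse_in (X : codeType) (c : X -> seq (seq nat)) (w : X -> seq nat) :
  recursive c -> recursive w -> r_e (fun s => inverse_in (c s) (w s)).
Proof.
move=> Cc Cw; apply: (r_e_exists (R := fun p => ev (w p.1 ++ subst (c p.1) p.2) = 1)).
apply: (r_e_preimage ev_re); apply: recursive_cat; first by apply: (recursive_comp Cw); rec.
by apply: recursive_subst; rec; apply: (recursive_comp Cc); rec.
Qed.

Lemma r_e_inverse_closed (X : codeType) (c : X -> seq (seq nat)) :
  recursive c -> r_e (fun s => inverse_closed (c s)).
Proof.
move=> Cc; apply: (r_e_all_in (R := fun p => inverse_in (c p.1) p.2)) => //.
by apply: r_e_inverse_in; rec; apply: (recursive_comp Cc); rec.
Qed.

Lemma r_e_list_gen (S : seq G) : r_e (fun w => list_gen S (ev w)).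
Proof.
have [C [Cinv CS]] := inverse_closed_words S.
apply: (r_e_ext (P := fun w => inverse_in C w)) => [w|].
  by rewrite -CS; apply: inverse_inP.
by apply: r_e_inverse_in; rec.
Qed.

Lemma cyclic_pow x y : list_gen [:: y] x -> exists k, x = y ^+ k \/ x = y ^- k.
Proof.
have ny : normalizes y (list_gen [::]).
  move=> z /list_gen_nil ->; rewrite !conj1g.
  by split; apply: (subgroup1 (list_gen_subgroup _)).
move=> /(list_gen_rcons_coset ny)[k [] /list_gen_nil e]; exists k; [left|right].
  by rewrite -(mulVKg (y ^+ k) x) e mulg1.
by rewrite -[LHS]invgK -(mulVKg (y ^+ k) x^-1) e mulg1.
Qed.

Section Meet.
Variable z : G.
Hypothesis z_central : forall x y, list_gen [:: z] x -> commute x y.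
Hypothesis z_torsion_free : forall x n, list_gen [:: z] x -> x ^+ n.+1 = 1 -> x = 1.

Definition meets_trivially Y B := (forall b, b \in B -> list_gen Y (ev b)) /\
  forall x, words_gen B x -> list_gen [:: z] x -> x = 1.

(* [t] generates the subgroup modulo [N = list_gen Y] and [C] generates its
   intersection with [N]. Either a power of [t] lies in the span of [C], or [t]
   has infinite order modulo [N]. *)
Definition meet_certificate Y y (p : seq (seq nat) * (seq (seq nat) * (seq nat * seq nat))) :=
  let: (B, (C, (t, t'))) := p in
  (inverse_closed C /\ meets_trivially Y C) /\
  ((ev (t ++ t') = 1 /\ list_gen (rcons Y y) (ev t)) /\
  ((forall c, c \in C -> inverse_in C (t' ++ c ++ t) /\ inverse_in C (t ++ c ++ t')) /\
  (((exists u, inverse_in C (t ++ subst [:: t] u)) \/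
    ((forall j, list_gen Y (y ^+ j) -> j = 0) /\
      (exists j, list_gen Y (y ^- j.+1 * ev t) \/ list_gen Y (y ^+ j.+1 * ev t)))) /\
  (forall b, b \in B -> exists u, inverse_in C (b ++ subst [:: t; t'] u))))).

Lemma r_e_meet_certificate Y y :
  r_e (meets_trivially Y) -> r_e (meet_certificate Y y).
Proof.
move=> reY; have [wy wyE] := ev_surj y; have [wy' wyE'] := ev_surj y^-1.
have powE w u : exists j, ev (w ++ subst [:: w] u) = ev w ^+ j.+1.
  suff [j jE] : exists j, ev (subst [:: w] u) = ev w ^+ j by exists j; rewrite ev_cat jE expgS.
  elim: u => [|[|i] u [j jE]]; first by exists 0.
    by exists j.+1; rewrite -(cat1s 0 u) ev_subst_cat jE ev_subst1 expgS.
  by exists j; rewrite -(cat1s i.+1 u) ev_subst_cat jE ev_subst1 /= nth_nil ev_nil mul1g.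
have powE' w j : exists u, ev (w ++ subst [:: w] u) = ev w ^+ j.+1.
  exists (nseq j 0); elim: j => [|j IHj]; first by rewrite cats0.
  by rewrite (ev_cat w) -[nseq _ _]/([:: 0] ++ nseq j 0) ev_subst_cat ev_subst1 -(ev_cat w) IHj -expgS.
(* [subst [:: wy] u] turns each letter 0 into [wy] and drops all others, so it runs through the
   powers of [wy]; the leading copy makes the exponent positive. *)
pose P' (t : seq nat) := exists u, list_gen Y (ev ((wy' ++ subst [:: wy'] u) ++ t)) \/
  list_gen Y (ev ((wy ++ subst [:: wy] u) ++ t)).
have P'E t : P' t <->
    exists j, list_gen Y (y ^- j.+1 * ev t) \/ list_gen Y (y ^+ j.+1 * ev t).
  split=> [[u [Pu|Pu]]|[j [Pj|Pj]]].
  - by have [j jE] := powE wy' u; exists j; left; rewrite -expVgn -wyE' -jE -ev_cat.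
  - by have [j jE] := powE wy u; exists j; right; rewrite -wyE -jE -ev_cat.
  - by have [u uE] := powE' wy' j; exists u; left; rewrite ev_cat uE wyE' expVgn.
  - by have [u uE] := powE' wy j; exists u; right; rewrite ev_cat uE wyE.
pose cert (p : seq (seq nat) * (seq (seq nat) * (seq nat * seq nat))) :=
  let B := p.1 in let C := p.2.1 in let t := p.2.2.1 in let t' := p.2.2.2 in
  (inverse_closed C /\ meets_trivially Y C) /\
  ((ev (t ++ t') = 1 /\ list_gen (rcons Y y) (ev t)) /\
  ((forall c, c \in C -> inverse_in C (t' ++ c ++ t) /\ inverse_in C (t ++ c ++ t')) /\
  (((exists u, inverse_in C (t ++ subst [:: t] u)) \/
    ((forall j, list_gen Y (y ^+ j) -> j = 0) /\ P' t)) /\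
  (forall b, b \in B -> exists u, inverse_in C (b ++ subst [:: t; t'] u))))).
apply: (@r_e_ext _ cert) => [[B [C [t t']]]|].
  by rewrite /cert /meet_certificate /= P'E.
apply: r_e_and.
  by apply: r_e_and; [apply: r_e_inverse_closed | apply: (r_e_preimage reY)]; rec.
apply: r_e_and.
  apply: r_e_and; first by apply: (r_e_preimage ev_re); apply: recursive_cat; rec.
  by apply: (r_e_preimage (r_e_list_gen (rcons Y y))); rec.
apply: r_e_and.
  apply: (r_e_all_in (s := fun p : seq (seq nat) * (seq (seq nat) * (seq nat * seq nat)) =>
      p.2.1) (R := fun q => inverse_in q.1.2.1 (q.1.2.2.2 ++ q.2 ++ q.1.2.2.1) /\
      inverse_in q.1.2.1 (q.1.2.2.1 ++ q.2 ++ q.1.2.2.2))); last by rec.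
  by apply: r_e_and; apply: r_e_inverse_in; rec; do !(apply: recursive_cat; rec).
apply: r_e_and; first apply: r_e_or.
- apply: (r_e_exists (R := fun q : seq (seq nat) * (seq (seq nat) * (seq nat * seq nat)) * seq nat
    => inverse_in q.1.2.1 (q.1.2.2.1 ++ subst [:: q.1.2.2.1] q.2))).
  apply: r_e_inverse_in; rec; apply: recursive_cat; rec.
  by apply: recursive_subst; rec; apply: recursive_cons; rec.
(* Whether [y] has infinite order modulo [list_gen Y] does not depend on the input. *)
- apply: r_e_and; first exact: r_e_const.
  apply: (r_e_preimage (P := P')); last by rec.
  apply: (r_e_exists (R := fun q => list_gen Y (ev ((wy' ++ subst [:: wy'] q.2) ++ q.1)) \/
    list_gen Y (ev ((wy ++ subst [:: wy] q.2) ++ q.1)))).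
  apply: r_e_or; apply: (r_e_preimage (r_e_list_gen Y));
    by do !(apply: recursive_cat; rec); apply: recursive_subst; rec.
apply: (r_e_all_in (s := fun p : seq (seq nat) * (seq (seq nat) * (seq nat * seq nat)) => p.1)
  (R := fun q => exists u, inverse_in q.1.2.1 (q.2 ++ subst [:: q.1.2.2.1; q.1.2.2.2] u)));
  last by rec.
apply: (r_e_exists (R := fun r => inverse_in r.1.1.2.1
  (r.1.2 ++ subst [:: r.1.1.2.2.1; r.1.1.2.2.2] r.2))).
apply: r_e_inverse_in; rec; apply: recursive_cat; rec.
by apply: recursive_subst; rec; apply: recursive_cons; rec; apply: recursive_cons; rec.
Qed.

(** Let [x] lie in both groups and [x * q] in the span [D] of [C], with [q] a power of [s]. If a
    positive power of [s] is in [D], then so is a power of [x], by centrality; it is 1, hence so is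
    [x], by torsion-freeness. Otherwise [s] has infinite order modulo [list_gen Y], which contains
    [x] and therefore [q], so [q = 1]. *)
Lemma meet_certificate_sound Y y p :
  normalizes y (list_gen Y) -> list_gen [:: z] `<=` list_gen Y ->
  meet_certificate Y y p -> meets_trivially (rcons Y y) p.1.
Proof.
case: p => B [C [t t']] ny zY [[Cinv [CY Cz]] [[tt' Yt] [conjC [cases BC]]]].
have memC w := inverse_inP w Cinv; pose D := words_gen C.
have sD : subgroup D := words_gen_subgroup C.
have sN := list_gen_subgroup Y; have sN' := list_gen_subgroup (rcons Y y).
have DN : D `<=` list_gen Y by apply: list_gen_min => // _ /mapP[c cC ->]; apply: CY.
set s := ev t in Yt.
have t'E : ev t' = s^-1 by apply/esym/mulg1_eq; rewrite -ev_cat.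
have nsD : normalizes s D.
  have sub : D `<=` [set x | D (x ^ s) /\ D (x ^ s^-1)].
    apply: list_gen_min => [|_ /mapP[c cC ->]].
      split; first split; rewrite /=.
      - by rewrite !conj1g; split; apply: (subgroup1 sD).
      - by move=> a b [? ?] [? ?]; rewrite /= !conjMg; split; apply: (subgroupM sD).
      - by move=> a [? ?]; rewrite /= !conjVg; split; apply: (subgroupV sD).
    have [/memC Dc /memC Dc'] := conjC c cC; move: Dc Dc'; rewrite !ev_cat t'E /=.
    by rewrite !conjgE invgK.
  exact: sub.
pose P := list_gen [:: s]; have sP : subgroup P := list_gen_subgroup _.
have nPD q : P q -> normalizes q D.
  apply: (@list_gen_min _ _ [set q | normalizes q D]); first exact: normalizer_subgroup.
  by move=> q'; rewrite inE => /eqP->.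
have PN' : P `<=` list_gen (rcons Y y).
  by apply: list_gen_min => // q; rewrite inE => /eqP->.
(* The product of [D] with the powers of [s]; it is a subgroup because [s] normalizes [D]. *)
pose S : set G := [set x | exists2 q, P q & D (x * q)].
have sS : subgroup S.
  split; first split.
  - by exists 1; rewrite ?mulg1; [apply: (subgroup1 sP) | apply: (subgroup1 sD)].
  - move=> a b [q Pq Daq] [r Pr Dbr]; exists (r * q); first exact: (subgroupM sP).
    have -> : a * b * (r * q) = (a * q) * (b * r) ^ q.
      by rewrite conjgE -!mulgA mulVKg.
    by apply: (subgroupM sD) => //; apply: (nPD q Pq _ Dbr).1.
  - move=> a [q Pq Daq]; exists q^-1; first exact: (subgroupV sP).
    have -> : a^-1 * q^-1 = ((a * q)^-1) ^ q^-1.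
      by rewrite conjgE invgK invgM -!mulgA mulVKg.
    by apply: (nPD q Pq _ (subgroupV sD Daq)).2.
have subB b : b \in B -> S (ev b).
  move=> /BC[u /memC]; rewrite ev_cat => Du; exists (ev (subst [:: t; t'] u)) => //.
  have := @words_gen_subst [:: t; t'] u; apply: list_gen_min => // q.
  rewrite !inE => /orP[/eqP->|/eqP->]; first by apply: mem_list_gen; rewrite inE.
  by rewrite t'E; apply: (subgroupV sP); apply: mem_list_gen; rewrite inE.
split=> [b /subB[q Pq Dbq]|x Bx zx].
  rewrite -(mulgK q (ev b)); apply: (subgroupM sN').
    by apply: list_gen_rcons; apply: DN.
  by apply: (subgroupV sN'); apply: PN'.
have [q Pq Dxq] : S x by apply: list_gen_min Bx => // _ /mapP[b /subB Sb ->].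
have Nq : list_gen Y q.
  rewrite -(mulKg x q); apply: (subgroupM sN); last exact: DN.
  by apply: (subgroupV sN); apply: zY.
have [k qE] := cyclic_pow Pq.
case: cases => [[u /memC]|[inf [j tj]]].
  have [n ->] : exists n, ev (t ++ subst [:: t] u) = s ^+ n.+1.
    suff [n nE] : exists n, ev (subst [:: t] u) = s ^+ n by exists n; rewrite ev_cat nE expgS.
    elim: u => [|[|i] u [n nE]]; first by exists 0.
      by exists n.+1; rewrite -(cat1s 0 u) ev_subst_cat nE ev_subst1 expgS.
    by exists n; rewrite -(cat1s i.+1 u) ev_subst_cat nE ev_subst1 /= nth_nil ev_nil mul1g.
  move=> Dsn; have Dqn : D (q ^+ n.+1).
    have Dskn : D ((s ^+ k) ^+ n.+1) by rewrite expgnAC; apply: (subgroupX _ sD).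
    by case: qE => ->; rewrite ?expVgn //; apply: (subgroupV sD).
  apply: (z_torsion_free (n := n)) => //; apply: Cz; last first.
    exact: (subgroupX _ (list_gen_subgroup _)).
  have xqn : (x * q) ^+ n.+1 = x ^+ n.+1 * q ^+ n.+1.
    by apply: expgMn; apply: z_central.
  rewrite -(mulgK (q ^+ n.+1) (x ^+ n.+1)) -xqn.
  by apply: (subgroupM sD); [apply: (subgroupX _ sD) | apply: (subgroupV sD)].
suff q1 : q = 1 by apply: Cz => //; rewrite q1 mulg1 in Dxq.
have Nsk : list_gen Y (s ^+ k).
  by case: qE => qE; move: Nq; rewrite qE // => /(subgroupV sN); rewrite invgK.
have {tj}Nyk : list_gen Y (y ^+ (j.+1 * k)).
  have nys := list_gen_rcons_normalizes ny Yt.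
  have ysk r : in_coset_pow (list_gen Y) y j.+1 r -> list_gen Y (r ^+ k) ->
      list_gen Y (y ^+ (j.+1 * k)).
    move=> /(coset_powX sN ny k); rewrite /in_coset_pow => Nyr Nr.
    rewrite -[y ^+ _](mulVKg (r ^+ k)) -[_^-1 * _]invgK invgM invgK.
    by apply: (subgroupM sN) => //; apply: (subgroupV sN).
  case: tj => [|Nys]; first by move=> /ysk; apply.
  apply: (ysk s^-1); last by rewrite expVgn; apply: (subgroupV sN).
  rewrite /in_coset_pow -invgM; apply: (subgroupV sN).
  have := (nys _ Nys).2; rewrite conjgE invgK mulgK.
  by [].
have k0 : k = 0 by have /eqP := inf _ Nyk; rewrite muln_eq0 /= => /eqP.
by case: qE; rewrite k0 ?expg0 ?invg1.
Qed.

(** [C] comes from finite generation of the intersection with [list_gen Y], and [t] spells an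
    element of least exponent. If [y] has finite order modulo [list_gen Y], a power of [s] falls
    into the intersection. *)
Lemma meet_certificate_complete Y y B :
  polycyclic Y -> normalizes y (list_gen Y) ->
  meets_trivially (rcons Y y) B -> exists q, meet_certificate Y y (B, q).
Proof.
move=> pY ny [BY Bz]; pose H := words_gen B.
have sH : subgroup H := words_gen_subgroup B.
have sN := list_gen_subgroup Y.
have HN' : H `<=` list_gen (rcons Y y).
  by apply: list_gen_min => [|_ /mapP[b bB ->]]; [apply: list_gen_subgroup | apply: BY].
have [|S SE] := polycyclic_noetherian pY (subgroupI sH sN); first by move=> x [].
have [C [Cinv CS]] := inverse_closed_words S.
have {CS}SE : H `&` list_gen Y = words_gen C by rewrite CS.
have memC w : H (ev w) -> list_gen Y (ev w) -> inverse_in C w.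
  by move=> Hw Nw; apply/(inverse_inP _ Cinv); rewrite -SE.
have [s Hs sgen] : exists2 s, H s & forall h, H h -> exists q, list_gen Y (h * s ^- q) \/
     list_gen Y (h^-1 * s ^- q).
  by apply: (coset_pow_gen sN ny _ sH) => x /HN'; apply: list_gen_rcons_coset.
have nsN := list_gen_rcons_normalizes ny (HN' s Hs).
have {}sgen := coset_pow_gen_normalizes sN nsN sgen.
have [t tE] := ev_surj s; have [t' t'E] := ev_surj s^-1.
have HCN c : c \in C -> H (ev c) /\ list_gen Y (ev c).
  move=> cC; have: (H `&` list_gen Y) (ev c) by rewrite SE; apply: mem_list_gen; apply: map_f.
  by [].
exists (C, (t, t')); split.
  split=> //; split=> [c /HCN[]//|x]; rewrite -/(words_gen C) -SE.
  by move=> [Hx _]; apply: Bz.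
split; first by rewrite ev_cat tE t'E mulgV; split=> //; apply: HN'.
split.
  move=> c /HCN[Hc Nc]; have [N1 N2] := nsN _ Nc.
  have := subgroupJ sH Hc Hs; have := subgroupJ sH Hc (subgroupV sH Hs).
  move: N1 N2; rewrite !conjgE invgK => N1 N2 H2 H1.
  by split; apply: memC; rewrite !ev_cat tE t'E.
have powt (w : seq nat) n : ev (subst [:: w] (nseq n 0)) = ev w ^+ n.
  elim: n => [|n IHn]; first by rewrite expg0 ev_nil.
  by rewrite -[nseq _ _]/([:: 0] ++ nseq n 0) ev_subst_cat ev_subst1 IHn -expgS.
split.
  case: (pselect (forall j, list_gen Y (y ^+ j) -> j = 0)) => [inf|ninf]; last first.
    left; have [j [j0 Nyj]] : exists j, 0 < j /\ list_gen Y (y ^+ j).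
      apply: contrapT => nj; case: ninf => j Nyj; case: j Nyj => // j Nyj.
      by case: nj; exists j.+1.
    exists (nseq j.-1 0); have e : ev (t ++ subst [:: t] (nseq j.-1 0)) = s ^+ j.
      by rewrite ev_cat powt tE -expgS prednK.
    apply: memC; rewrite e; first exact: (subgroupX _ sH).
    have red r i : in_coset_pow (list_gen Y) y i r -> list_gen Y (r ^+ j).
      move=> /(coset_powX sN ny j); rewrite /in_coset_pow => Nr.
      rewrite -(mulVKg (y ^+ (i * j)) (r ^+ j)); apply: (subgroupM sN) => //.
      by rewrite mulnC expgnA; apply: (subgroupX _ sN).
    have [i [/red //|/red]] := list_gen_rcons_coset ny (HN' s Hs).
    by rewrite expVgn => /(subgroupV sN); rewrite invgK.
  have [[|i] si] := list_gen_rcons_coset ny (HN' s Hs).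
    (* Exponent 0 puts [s] itself in the intersection, so its first power already serves. *)
    left; exists [::]; apply: memC; rewrite cats0 tE //.
    case: si => /coset_pow0 //; by move/(subgroupV sN); rewrite invgK.
  right; split=> //; exists i; rewrite tE; case: si => si; [by left | right].
  have := (nsN _ (subgroupV sN si)).1.
  by rewrite invgM !invgK conjgE mulgA mulKg.
move=> b bB; have Hb : H (ev b) by apply: mem_list_gen; apply: map_f.
have powt2 n : ev (subst [:: t; t'] (nseq n 0)) = s ^+ n.
  elim: n => [|n IHn]; first by rewrite expg0 ev_nil.
  by rewrite -[nseq _ _]/([:: 0] ++ nseq n 0) ev_subst_cat ev_subst1 IHn tE -expgS.
have powt2' n : ev (subst [:: t; t'] (nseq n 1%N)) = s ^- n.
  elim: n => [|n IHn]; first by rewrite invg1 ev_nil.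
  by rewrite -[nseq _ _]/([:: 1%N] ++ nseq n 1%N) ev_subst_cat ev_subst1 IHn t'E -!expVgn -expgS.
have [q [Nb|Nb]] := sgen _ Hb.
  exists (nseq q 1%N); apply: memC; rewrite ev_cat powt2' //.
  by apply: (subgroupM sH) => //; apply: (subgroupV sH); apply: (subgroupX _ sH).
exists (nseq q 0); apply: memC; rewrite ev_cat powt2 //.
by apply: (subgroupM sH) => //; apply: (subgroupX _ sH).
Qed.

Lemma polycyclic_rcons_inv Y y : polycyclic (rcons Y y) ->
  polycyclic Y /\ normalizes y (list_gen Y).
Proof.
move E: (rcons Y y) => Y' pY'; case: pY' E => [/(congr1 size)|Z x pZ nx].
  by rewrite size_rcons.
by move=> /rcons_inj[-> ->].
Qed.

(** Starting the sequence with [z] keeps [z] in every prefix, as soundness requires. For the prefix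
    [[:: z]] the condition says that all words have value 1. *)
Lemma r_e_meets_trivially Y :
  polycyclic (z :: Y) -> r_e (meets_trivially (z :: Y)).
Proof.
elim/last_ind: Y => [|Y y IHY] pY.
  apply: (@r_e_ext _ (fun B => forall b, b \in B -> ev b = 1)) => [B|].
    split=> [B1|[Bz B0] b bB]; last first.
      by apply: B0 (Bz b bB); apply: mem_list_gen; apply: map_f.
    have sz := list_gen_subgroup [:: z]; split=> [b /B1->|x Bx _]; first exact: (subgroup1 sz).
    apply: list_gen_nil; apply: list_gen_min Bx => [|_ /mapP[b /B1-> ->]].
      exact: list_gen_subgroup.
    exact: (subgroup1 (list_gen_subgroup _)).
  apply: (r_e_all_in (R := fun p : seq (seq nat) * seq nat => ev p.2 = 1)); last by rec.
  by apply: (r_e_preimage ev_re); rec.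
have [pY' ny] := polycyclic_rcons_inv (pY : polycyclic (rcons (z :: Y) y)).
have reC := r_e_meet_certificate y (IHY pY').
apply: (r_e_ext _ (r_e_exists reC)) => B; split=> [[q /meet_certificate_sound]|].
  apply => //; apply: list_gen_min; first exact: list_gen_subgroup.
  by move=> x; rewrite inE => /eqP->; apply: mem_list_gen; rewrite inE eqxx.
exact: (@meet_certificate_complete (z :: Y) y B pY' ny).
Qed.

End Meet.
End Certificates.

(** * The algorithm *)

Section DirectProduct.
Variable G : groupType.
Local Notation GZ := (G * additive_group int)%type.
Local Notation inG := (fun g : G => (g, 0%R) : GZ).

Definition counter : GZ := (1, 1%R).

Lemma fst_expg (p : GZ) n : (p ^+ n).1 = p.1 ^+ n.
Proof. by elim: n => // n IHn; rewrite !expgS -IHn. Qed.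

Lemma snd_expg (p : GZ) n : (p ^+ n).2 = (p.2 *+ n)%R.
Proof. by elim: n => // n IHn; rewrite expgS GRing.mulrS -IHn. Qed.

Lemma counterX n : counter ^+ n = (1, Posz n).
Proof.
rewrite [LHS]surjective_pairing fst_expg snd_expg expg1n; congr pair.
exact: ssrint.natz.
Qed.

Lemma counter_fst (p : GZ) : list_gen [:: counter] p -> p.1 = 1.
Proof.
apply: (@list_gen_min _ _ [set p : GZ | p.1 = 1]); last first.
  by move=> q; rewrite inE => /eqP->.
split; first split => //.
  by move=> p1 p2 /= e1 e2; rewrite e1 e2 mulg1.
by move=> p1 /= ->; rewrite invg1.
Qed.

Lemma counter_gen k : list_gen [:: counter] (1, k).
Proof.
have sz := list_gen_subgroup [:: counter].
have zz : list_gen [:: counter] counter by apply: mem_list_gen; rewrite inE.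
case: k => n; first by rewrite -counterX; apply: (subgroupX _ sz).
have -> : ((1, Negz n) : GZ) = counter ^- n.+1.
  by rewrite counterX -[RHS]/((1^-1, (- Posz n.+1)%R) : GZ) invg1 ssrint.NegzE.
by apply: (subgroupV sz); apply: (subgroupX _ sz).
Qed.

Lemma counter_central (p q : GZ) : list_gen [:: counter] p -> commute p q.
Proof.
case: p q => [g m] [h l] /counter_fst /= ->.
by congr pair; rewrite /= ?mul1g ?mulg1 //; apply: GRing.addrC.
Qed.

Lemma counter_torsion_free (p : GZ) n :
  list_gen [:: counter] p -> p ^+ n.+1 = 1 -> p = 1.
Proof.
move=> /counter_fst p1 /(congr1 snd); rewrite snd_expg => e.
have p2 : (p.2 : int) = 0%R.
  have {}e : ((p.2 : int) *+ n.+1)%R = 0%R by exact: e.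
  by apply/eqP; move/eqP: e; rewrite Num.Theory.mulrn_eq0.
by rewrite [p]surjective_pairing p1 p2.
Qed.

Lemma list_gen_counter (Y : seq G) (p : GZ) :
  list_gen (counter :: map inG Y) p <-> list_gen Y p.1.
Proof.
have sP := list_gen_subgroup (counter :: map inG Y); have sY := list_gen_subgroup Y.
split=> [|Yp].
  apply: (@list_gen_min _ _ [set p : GZ | list_gen Y p.1]).
    exact: (@subgroup_preim _ _ fst _ (fun _ _ => erefl) erefl (fun _ => erefl) sY).
  move=> q; rewrite inE => /orP[/eqP->|/mapP[g gY ->]]; first exact: (subgroup1 sY).
  exact: mem_list_gen.
have -> : p = inG p.1 * (1, p.2).
  by case: p {Yp} => g k; rewrite -[RHS]/((g * 1, (0 + k : int)%R) : GZ) mulg1 GRing.add0r.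
apply: (subgroupM sP).
  apply: (@list_gen_min _ _ [set g | list_gen (counter :: map inG Y) (inG g)]) Yp.
    exact: (@subgroup_preim _ _ inG).
  by move=> g gY; apply: mem_list_gen; rewrite inE map_f ?orbT.
apply: (@list_gen_min _ [:: counter]) (counter_gen p.2) => // q.
by rewrite inE => /eqP->; apply: mem_list_gen; rewrite inE eqxx.
Qed.

Lemma polycyclic_counter (Y : seq G) : polycyclic Y -> polycyclic (counter :: map inG Y).
Proof.
elim=> {Y} [|Y y pY IHY ny].
  apply: (@Polycyclic_rcons _ [::]); first exact: Polycyclic_nil.
  move=> p /list_gen_nil ->; rewrite !conj1g.
  by split; apply: (subgroup1 (list_gen_subgroup _)).
rewrite map_rcons -rcons_cons; apply: Polycyclic_rcons => // p.
by move=> /list_gen_counter /ny[n1 n2]; split; apply/list_gen_counter.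
Qed.

End DirectProduct.

Section Algorithm.
Variables (G : groupType) (X Y : seq G).
Hypothesis pY : polycyclic Y.
Hypothesis genY : list_gen Y = [set: G].
Hypothesis nilG : nilpotent_group G.

Local Notation GZ := (G * additive_group int)%type.
Let Yz : seq GZ := counter G :: map (fun g : G => (g, 0%R) : GZ) Y.
Let ev := word_eval Yz.
Let pYz : polycyclic Yz. Proof. exact: polycyclic_counter. Qed.

Let ev_surj p : exists w, ev w = p.
Proof. by apply/list_genP; apply/list_gen_counter; rewrite genY. Qed.

Let ev_nil : ev [::] = 1. Proof. exact: word_eval_nil. Qed.
Let ev_cat u v : ev (u ++ v) = ev u * ev v. Proof. exact: word_eval_cat. Qed.
Let ev_re : r_e (fun w => ev w = 1). Proof. exact: polycyclic_word_problem. Qed.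

Let val := word_eval X.

Definition values (A : seq (seq nat)) : set G := [set val w | w in [set` A]].

(** Inputs are spelled in [X], whereas the search works over a polycyclic sequence of the product
    with the integers. *)
Let translation : exists T, forall w, ev (subst T w) = (val w, 0%R).
Proof.
have /choice[t tE] l : exists w, ev w = (letter_eval X l, 0%R) by apply: ev_surj.
exists (mkseq t (size X).*2); elim=> [|l w IHw].
  by rewrite ev_nil /val word_eval_nil.
rewrite -cat1s /subst map_cat flatten_cat ev_cat -/(subst _ w) IHw /= cats0.
have -> : ev (nth [::] (mkseq t (size X).*2) l) = (letter_eval X l, 0%R).
  have [lt_l|le_l] := ltnP l (size X).*2; first by rewrite nth_mkseq.
  rewrite nth_default ?size_mkseq // ev_nil letter_eval_out //.
  by have := half_leq le_l; rewrite doubleK.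
rewrite /val -(cat1s l w) word_eval_cat word_eval_seq1.
by congr pair; rewrite /= GRing.addr0.
Qed.

Definition invertible_list A := forall w, w \in A -> monoid_gen (values A) (val w)^-1.

(** Letter 0 denotes [counter G], the head of [Yz], so the appended power records the weight. *)
Definition weighted (T : seq (seq nat)) (p : seq nat * nat) :=
  subst T p.1 ++ word_pow [:: 0] p.2.

(* The weights [p.2] extend to a homomorphism from the subgroup generated by
   the values [val p.1] to the integers exactly when the elements
   [(val p.1, p.2)] of [G * Z] generate the graph of a function. *)
Definition descent T (q : seq (seq nat) * seq (seq nat)) :=
  (q.2 = q.1 /\ inverse_closed ev (map (subst T) q.1)) \/
  exists P : seq (seq nat * nat),
    (map fst P = q.1 /\ meets_trivially ev (counter G) Yz (map (weighted T) P)) /\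
    (q.2 = foldr (fun p s => if p.2 is _.+1 then s else p.1 :: s) [::] P /\
     size q.2 < size q.1).

Lemma r_e_descent T : r_e (descent T).
Proof.
have reM : r_e (meets_trivially ev (counter G) Yz).
  apply: r_e_meets_trivially => //; [exact: counter_central | exact: counter_torsion_free].
apply: r_e_or.
  apply: r_e_and; first by apply: r_e_eq; rec.
  apply: r_e_inverse_closed => //.
  by apply: (recursive_map (f := fun p => subst T p.2)); rec; apply: recursive_subst; rec.
apply: (r_e_exists (R := fun r : seq (seq nat) * seq (seq nat) * seq (seq nat * nat) =>
  (map fst r.2 = r.1.1 /\ meets_trivially ev (counter G) Yz (map (weighted T) r.2)) /\
  (r.1.2 = foldr (fun p s => if p.2 is _.+1 then s else p.1 :: s) [::] r.2 /\
     size r.1.2 < size r.1.1))).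
apply: r_e_and; apply: r_e_and.
- by apply: r_e_eq; rec; apply: (recursive_map (f := fun p => p.2.1)); rec.
- apply: (r_e_preimage reM); apply: (recursive_map (f := fun p => weighted T p.2)); rec.
  apply: recursive_cat; first by apply: recursive_subst; rec.
  by apply: recursive_word_pow; rec.
- apply: r_e_eq; rec.
  apply: (recursive_foldr (g := fun p => if p.2.1.2 is _.+1 then p.2.2 else p.2.1.1 :: p.2.2)); rec.
  apply: (recursive_ifS (k := fun p => p.2.1.2) (b := fun p => p.2.2)
    (a := fun p => p.2.1.1 :: p.2.2)); rec.
  by apply: recursive_cons; rec.
- by apply: r_e_lt; apply: recursive_size; rec.
Qed.

Section Descent.
Variable T : seq (seq nat).
Hypothesis ev_subst : forall w, ev (subst T w) = (val w, 0%R).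

Let ev_weighted p : ev (weighted T p) = (val p.1, Posz p.2).
Proof.
have z0 : ev [:: 0] = counter G by exact: word_eval_seq1.
rewrite /weighted ev_cat ev_subst [ev (word_pow _ _)]word_eval_pow -/ev z0 counterX.
by rewrite -[LHS]/((val p.1 * 1, (0 + Posz p.2 : int)%R) : GZ) mulg1 GRing.add0r.
Qed.

Let ev_list A u : ev (subst (map (subst T) A) u) = (val (subst A u), 0%R).
Proof.
elim: u => [|i u IHu]; first by rewrite ev_nil /val word_eval_nil.
rewrite !subst_cons ev_cat IHu.
have -> : ev (nth [::] (map (subst T) A) i) = (val (nth [::] A i), 0%R).
  have [lt_i|le_i] := ltnP i (size A); first by rewrite (nth_map [::]).
  by rewrite !nth_default ?size_map // ev_nil /val word_eval_nil.
by rewrite /val word_eval_cat -[LHS]/((_ * _, (0 + 0 : int)%R) : GZ) GRing.addr0.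
Qed.

Lemma monoid_gen_valuesP A x :
  monoid_gen (values A) x <-> exists u, x = val (subst A u).
Proof.
have [M1 MM] := monoid_gen_submonoid (values A).
split=> [|[u ->]].
  apply: (@monoid_gen_min _ _ [set x | exists u, x = val (subst A u)]).
    split; first by exists [::]; rewrite /val word_eval_nil.
    move=> _ _ [u ->] [v ->]; exists (u ++ v).
    by rewrite subst_cat /val word_eval_cat.
  move=> _ [w wA <-]; exists [:: index w A].
  by rewrite /subst /= cats0 nth_index.
elim: u => [|i u IHu]; first by rewrite /val word_eval_nil.
rewrite subst_cons /val word_eval_cat.
apply: MM => //; have [lt_i|le_i] := ltnP i (size A).
  by apply: mem_monoid_gen; exists (nth [::] A i); rewrite //= mem_nth.
by rewrite nth_default // word_eval_nil.
Qed.

Lemma invertible_listP A :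
  inverse_closed ev (map (subst T) A) <-> invertible_list A.
Proof.
split=> [Ainv w wA|Ainv _ /mapP[w wA ->]].
  have [u] := Ainv _ (map_f _ wA); rewrite ev_cat ev_subst ev_list.
  move=> /(congr1 fst) /mulg1_eq e; apply/monoid_gen_valuesP; exists u; exact: e.
have /monoid_gen_valuesP[u uE] := Ainv w wA; exists u.
rewrite ev_cat ev_subst ev_list -uE.
by rewrite -[LHS]/((val w * (val w)^-1, (0 + 0 : int)%R) : GZ) mulgV GRing.addr0.
Qed.

Let kernel (P : seq (seq nat * nat)) :=
  foldr (fun p s => if p.2 is _.+1 then s else p.1 :: s) [::] P.

Let mem_kernel P w : (w \in kernel P) = ((w, 0) \in P).
Proof.
elim: P => //= [[v [|n]] P IHP]; rewrite !inE ?IHP //=.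
  by rewrite xpair_eqE andbT.
by rewrite xpair_eqE andbF.
Qed.

Let size_kernel_lt P p : p \in P -> 0 < p.2 -> size (kernel P) < size P.
Proof.
have le Q : size (kernel Q) <= size Q by elim: Q => //= [[v [|n]] Q IHQ] //=; apply: leqW.
elim: P => //= [[v n] P IHP]; rewrite inE => /orP[/eqP->|/IHP{}IHP p0].
  by case: n => //= n _; rewrite ltnS.
by case: n => [|n] /=; rewrite ltnS; [apply: IHP | apply: le].
Qed.

Let kernel_sub P : {subset kernel P <= map fst P}.
Proof. by move=> w; rewrite mem_kernel => /(map_f fst). Qed.

(* A weight that is nonnegative on the generators and vanishes on a product
   equal to 1 vanishes on every factor. *)
Lemma weight_zero (P : seq (seq nat * nat)) p :
  meets_trivially ev (counter G) Yz (map (weighted T) P) -> p \in P ->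
  monoid_gen (values (map fst P)) (val p.1)^-1 ->
  p.2 = 0 /\ monoid_gen (values (kernel P)) (val p.1)^-1.
Proof.
move=> [_ trivP] pP; set L := list_gen (map ev (map (weighted T) P)) in trivP.
have sL : subgroup L := list_gen_subgroup _.
have [M1 MM] := monoid_gen_submonoid (values (kernel P)).
have LP q : q \in P -> L (val q.1, Posz q.2).
  by move=> qP; rewrite -ev_weighted; apply: mem_list_gen; do 2 apply: map_f.
(* Every element of the monoid is paired with a total weight, which is zero only if all factors have
   weight zero. *)
pose S : set G := [set x | exists n, L (x, Posz n) /\
  (n = 0 -> monoid_gen (values (kernel P)) x)].
have sub : monoid_gen (values (map fst P)) `<=` S.
  apply: monoid_gen_min => [|_ [w /mapP[q qP ->] <-]].
    split; first by exists 0; split=> //; apply: (subgroup1 sL).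
    move=> x y [n [Lx Kx]] [m [Ly Ky]]; exists (n + m); split.
      by have := subgroupM sL Lx Ly; rewrite -[(_, _) * _]/(x * y, Posz (n + m)).
    by move=> /eqP; rewrite addn_eq0 => /andP[/eqP/Kx Mx /eqP/Ky My]; apply: MM.
  exists q.2; split=> [|q0]; first exact: LP.
  apply: mem_monoid_gen; exists q.1 => //=.
  by rewrite mem_kernel -q0 -surjective_pairing.
move=> /sub[n [Ln Kn]]; have := subgroupM sL (LP p pP) Ln.
rewrite -[(_, _) * _]/(val p.1 * (val p.1)^-1, Posz (p.2 + n)) mulgV => L1.
have pn0 : p.2 + n = 0.
  exact: (congr1 (fun q : GZ => absz q.2) (trivP _ L1 (@counter_gen G _))).
have /andP[/eqP-> /eqP/Kn] : (p.2 == 0) && (n == 0) by rewrite -addn_eq0 pn0.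
by [].
Qed.

Lemma values_sub A B : {subset A <= B} -> values A `<=` values B.
Proof. by move=> AB _ [w wA <-]; exists w => //; apply: AB. Qed.

Lemma monoid_gen_sub (S S' : set G) : S `<=` S' -> monoid_gen S `<=` monoid_gen S'.
Proof.
move=> SS'; apply: monoid_gen_min; first exact: monoid_gen_submonoid.
by move=> x /SS'; apply: mem_monoid_gen.
Qed.

Lemma descent_invertible_part A A' : descent T (A, A') ->
  {subset A' <= A} /\
  invertible_part (values A) = invertible_part (values A').
Proof.
case=> [[/= -> _]|[P [[/= AE trivP] [/= A'E _]]]]; first by split.
rewrite -/(kernel P) in A'E; rewrite {}A'E -{}AE.
have subP := @kernel_sub P; split=> //.
apply/seteqP; split=> x [[w /= wA <-] Mx]; last first.
  split; first by exists w => //; apply: subP.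
  by apply: monoid_gen_sub Mx; apply: values_sub.
have /mapP[p pP we] := wA; rewrite we in Mx *.
have [p0 Kp] := weight_zero trivP pP Mx; split=> //.
by exists p.1 => //=; rewrite mem_kernel -p0 -surjective_pairing.
Qed.

(** If all elements are invertible, every admissible weight vanishes and the kernel cannot be
    shorter. Surplus iterations are therefore harmless. *)
Lemma descent_invertible A A' : descent T (A, A') -> invertible_list A -> A' = A.
Proof.
case=> [[]//|[P [[/= AE trivP] [/= A'E lt_A]]]] invA.
move: lt_A; rewrite A'E -/(kernel P) -AE size_map.
suff -> : kernel P = map fst P by rewrite size_map ltnn.
have P0 p : p \in P -> p.2 = 0.
  move=> pP; have [] // := weight_zero trivP pP.
  by rewrite AE; apply: invA; rewrite -AE map_f.
elim: P P0 {AE trivP A'E} => //= [[w n] P IHP] P0.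
rewrite (P0 (w, n)) ?inE ?eqxx //= IHP // => p pP.
by apply: P0; rewrite inE pP orbT.
Qed.

Lemma descent_progress A A' : descent T (A, A') ->
  size A' < size A \/ A' = A /\ invertible_list A.
Proof. by case=> [[/= ? /invertible_listP ?]|[P [_ [_ ?]]]]; [right | left]. Qed.

Lemma descent_total A : exists A', descent T (A, A').
Proof.
pose a (i : 'I_(size A)) := val (nth [::] A i).
have rangeE : range a = values A.
  apply/seteqP; split=> [_ [i _ <-]|_ [w wA <-]].
    by exists (nth [::] A i) => //=; apply: mem_nth.
  have lt_w : index w A < size A by rewrite index_mem.
  by exists (Ordinal lt_w); rewrite // /a nth_index.
have [inv|[f [j fj] graphf]] := @nilpotent_dichotomy G _ a nilG.
  exists A; left; split=> //; apply/invertible_listP => w wA.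
  have lt_w : index w A < size A by rewrite index_mem.
  by have := inv (Ordinal lt_w); rewrite rangeE /a nth_index.
(* Weights are attached to positions in [A]; the positive one at [j] makes the kernel shorter. *)
pose P := [seq (nth [::] A i, f i) | i : 'I_(size A) <- enum 'I_(size A)].
exists (kernel P); right; exists P.
have PA : map fst P = A.
  rewrite -map_comp -[RHS](mkseq_nth [::]) /mkseq -val_enum_ord -map_comp.
  by apply: eq_map.
split; split=> //.
  split=> [b _|x]; first by apply/list_gen_counter; rewrite genY.
  have : list_gen (map ev (map (weighted T) P)) `<=` graph_gen a (fun i => Posz (f i)).
    apply: list_gen_min; first exact: graph_gen_subgroup.
    move=> _ /mapP[_ /mapP[p /mapP[i _ ->] ->] ->]; rewrite ev_weighted.
    by apply: mem_subgroup_gen; exists i.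
  move=> sub /sub; case: x => g k Lx /counter_fst /= g1; rewrite g1 in Lx *.
  by rewrite (graphf k Lx).
rewrite -[in X in _ < X]PA size_map; apply: (@size_kernel_lt _ (nth [::] A j, f j)) => //.
by apply: (map_f (fun i : 'I_(size A) => (nth [::] A i, f i))); rewrite mem_enum.
Qed.

End Descent.

(** A step shortens the list or fixes one whose elements are all invertible, so [size A] steps
    suffice. The inclusion in [A] ensures that the output consists of codes of genuine words. *)
Theorem recursive_invertible_part : exists2 F : seq (seq nat) -> seq (seq nat),
  recursive F & forall A, {subset F A <= A} /\
    values (F A) = invertible_part (values A).
Proof.
have [T TE] := translation.
have [step Cstep stepP] := r_e_selection (r_e_descent T) (descent_total TE).
exists (fun A => iter (size A) step A) => [|A].
  apply: (recursive_ext _ (recursive_natrec (k := fun A => size A) (a := fun A => A)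
    (g := fun p => step p.2.2) _ _ _)) => [A||| ].
  - by elim: (size A) => //= n ->.
  - by apply: recursive_size; rec.
  - by rec.
  - by apply: (recursive_comp Cstep); rec.
have iterP n B : {subset iter n step B <= B} /\
    invertible_part (values B) = invertible_part (values (iter n step B)).
  elim: n => [|n [sub eqv]]; first by split.
  rewrite iterS.
  have [sub' eqv'] := descent_invertible_part TE (stepP (iter n step B)).
  by rewrite eqv eqv'; split=> // w /sub' /sub.
have iter_inv n B : invertible_list B -> iter n step B = B.
  move=> invB; elim: n => //= n ->; exact: (descent_invertible TE (stepP B) invB).
have inv n B : size B <= n -> invertible_list (iter n step B).
  elim: n B => [|n IHn] B; first by rewrite leqn0 size_eq0 => /eqP->.
  rewrite iterSr; case: (descent_progress TE (stepP B)) => [lt_B le_B|[eqB invB] _].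
    by apply: IHn; rewrite -ltnS; apply: leq_trans lt_B le_B.
  by rewrite eqB iter_inv.
have [sub eqv] := iterP (size A) A; split=> //; rewrite eqv.
apply/seteqP; split=> [_ [w wF <-]|x []//]; split; first by exists w.
exact: (inv _ _ (leqnn _) w wF).
Qed.

End Algorithm.

(** The first factor of a nonempty product equal to 1 is invertible, its inverse being the product
    of the others; conversely [g * g^-1] is such a product. *)
Lemma semigroup_gen_one (G : groupType) (A : set G) :
  semigroup_gen A 1 <-> invertible_part A !=set0.
Proof.
have sgM x y : semigroup_gen A x -> semigroup_gen A y -> semigroup_gen A (x * y).
  by move=> Ax Ay S sAS; apply: (sAS.1); [apply: Ax | apply: Ay].
have [M1 MM] := monoid_gen_submonoid A.
split=> [|[g [Ag]]].
  pose S x := exists2 g, A g & exists2 m, monoid_gen A m & x = g * m.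
  have: semigroup_gen A `<=` S.
    apply: smallest_sub => [_ _ [g Ag [m Mm ->]] [h Ah [p Mp ->]]|g Ag].
      exists g => //; exists (m * (h * p)); last by rewrite !mulgA.
      by do 2 apply: (MM) => //; apply: mem_monoid_gen.
    by exists g => //; exists 1; rewrite ?mulg1.
  move=> sub /sub[g Ag [m Mm /esym/mulg1_eq e]].
  by exists g; split=> //; rewrite e.
suff sub : monoid_gen A `<=` [set x | x = 1 \/ semigroup_gen A x].
  have Sg : semigroup_gen A g by apply: sub_gen_smallest.
  move=> /sub[/eqP|Sg']; last by rewrite -(mulgV g); apply: sgM.
  by rewrite invg_eq1 => /eqP <-.
apply: monoid_gen_min => [|x Ax]; last by right; apply: sub_gen_smallest.
split; first by left.
move=> x y [->|Sx] [->|Sy]; rewrite /= ?mulg1 ?mul1g; by [left | right | right; apply: sgM].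
Qed.

(** * Passage to encoded words *)

Lemma word_valE (G : groupType) k (X : k.-tuple G) (w : word k) :
  word_val X w = word_eval X (map (@encode_letter k) w).
Proof.
rewrite /word_val /word_eval big_map; apply: eq_bigr => -[i b] _.
rewrite /encode_letter /= (tnth_nth 1); case: b; first by rewrite addn1 letter_eval_doubleS.
by rewrite addn0 letter_eval_double.
Qed.

Lemma set_of_wordsE (G : groupType) k (X : k.-tuple G) (A : seq (word k)) :
  set_of_words X A = values X (map (map (@encode_letter k)) A).
Proof.
apply/seteqP; split=> [_ [w wA <-]|_ [_ /= /mapP[w wA ->] <-]].
  by exists (map (@encode_letter k) w); [apply: map_f | rewrite word_valE].
by exists w => //; rewrite word_valE.
Qed.

Lemma encode_wordsE k (A : seq (word k)) :
  encode_words A = enc (map (map (@encode_letter k)) A).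
Proof.
rewrite /encode_words /enc /= -map_comp; congr CodeSeq.code; apply: eq_map => w /=.
by apply: (congr1 CodeSeq.code); rewrite -[LHS]map_id.
Qed.

Lemma sub_map_preimage (S T : eqType) (f : S -> T) (s : seq S) (t : seq T) :
  {subset t <= map f s} -> exists r, map f r = t.
Proof.
elim: t => [|y t IHt] sub; first by exists [::].
have [|r rE] := IHt; first by move=> z zt; apply: sub; rewrite inE zt orbT.
have /mapP[x _ ->] : y \in map f s by apply: sub; rewrite inE eqxx.
by exists (x :: r); rewrite /= rE.
Qed.

Lemma computable_of_recursive (Z : codeType) k (F : seq (seq nat) -> Z)
    (W : Type) (encW : W -> nat) (f : seq (word k) -> W) :
  recursive F ->
  (forall A, encW (f A) = enc (F (map (map (@encode_letter k)) A))) ->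
  computable (@encode_words k) encW f.
Proof.
move=> [p pP] fE; exists p => A.
have := pP [tuple encode_words A].
by rewrite fE encode_wordsE [tnth _ _]/(enc _) encK.
Qed.

Theorem mainTheorem3 (G : groupType) (k : nat) (X : k.-tuple G)
    (nilG : nilpotent_group G) (genX : generating X) :
  [/\ exists f : seq (word k) -> seq (word k),
        computable (@encode_words k) (@encode_words k) f /\
        forall A : seq (word k),
          set_of_words X (f A) = invertible_part (set_of_words X A),
      forall A : seq (word k),
        semigroup_gen (set_of_words X A) 1 <->
        invertible_part (set_of_words X A) !=set0
    & decidable_problem (@encode_words k) (identity_problem X)].
Proof.
have gen_list : list_gen X = [set: G].
  rewrite -genX /list_gen; congr subgroup_gen; apply/seteqP.
  by split=> [_ /= /tnthP[i ->]|_ [i _ <-]]; [exists i | rewrite /= mem_tnth].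
have [Y pY genY] := nilpotent_polycyclic nilG gen_list.
have [F CF FP] := recursive_invertible_part X pY genY nilG.
have /choice[f fE] (A : seq (word k)) : exists B : seq (word k),
    map (map (@encode_letter k)) B = F (map (map (@encode_letter k)) A).
  by have [sub _] := FP (map (map (@encode_letter k)) A); apply: sub_map_preimage sub.
have fP A : set_of_words X (f A) = invertible_part (set_of_words X A).
  by rewrite !set_of_wordsE fE; have [_ ->] := FP (map (map (@encode_letter k)) A).
have id1 A := semigroup_gen_one (set_of_words X A).
split=> //.
  exists f; split=> //; apply: (computable_of_recursive CF) => A.
  by rewrite encode_wordsE fE.
(* The empty sequence is the only one with code 0, so the code decides nonemptiness. *)
pose sg A := if enc (F A) is _.+1 then 1%N else 0%N.
exists (fun A => f A != [::]); split.
  apply: (@computable_of_recursive nat_codeType _ sg) => [|A].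
    by apply: recursive_ifS; [apply: recursive_enc | apply: recursive_const | apply: recursive_const].
  rewrite /sg -fE; case: (f A) => [|w B] //=; by rewrite enc_cons.
move=> A; rewrite /identity_problem id1 -fP; split=> [|[g [w /= wf _]]].
  case: (f A) => // w B _; exists (word_val X w), w => //=; by rewrite inE eqxx.
by case: (f A) wf.
Qed.
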